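(* Let $p\ge1$, let $S\subset\mathbb{R}^p$ be a compact set with nonempty interior such that a ball of radius $R>0$ rolls inside and outside $S$, and let $w:S\to\mathbb{R}$, $w\ge0$, satisfy $L(\delta)\ge C\delta^r$ for all $\delta\ge0$, with constants $C>0$ and $r\ge0$, where $L(\delta)=\inf\{w(x):x\in S,\ d(x,\partial S)\ge\delta\}$. Let $\mu$ be the probability measure supported on $S$ with density $w$ with respect to Lebesgue measure. Then for every integer $d\ge2$, $$\sup_{x\in S}\kappa_{\mu,d}(x,x)\le\frac{4^{p+r}s(d)}{C\omega_pR^{p+r}}\,\frac{(d+p+1)(d+p+2)(2d+p+6)}{(d+1)(d+2)(d+3)}+\frac{2^{p+2r}c_r}{CR^{p+r}}\left[2\binom{p+d+2r+1}{d}-\binom{p+d+2r}{d}\right].$$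
   Context: Rolling balls: for a closed set $F\subset\mathbb{R}^p$, a ball of radius $R$ rolls inside $F$ if for every $x\in F$ there is a closed Euclidean ball $B_x$ of radius $R$ with $x\in B_x\subset F$; it rolls outside $F$ if it rolls inside $\overline{F^c}$. $d(x,A)=\inf_{y\in A}\|x-y\|_2$. $\Pi_d^p$ is the space of real polynomials in $p$ variables of degree at most $d$, and $s(d)=\dim\Pi_d^p=\binom{d+p}{d}$. $\kappa_{\mu,d}$ (Christoffel–Darboux kernel) is the reproducing kernel of $\Pi_d^p$ equipped with $\langle P,Q\rangle_\mu=\int PQ\,d\mu$, i.e. $\kappa_{\mu,d}(x,y)=\sum_jP_j(x)P_j(y)$ for any orthonormal basis $(P_j)$. $\omega_p=\frac{2\pi^{(p+1)/2}}{\Gamma((p+1)/2)}$ is the surface area of the $p$-dimensional unit sphere in $\mathbb{R}^{p+1}$; $c_r=\frac{\Gamma(p/2+r+1)}{\pi^{p/2}\Gamma(r+1)}$; for $a\in\mathbb{R}$, $k\in\mathbb{N}$, $\binom ak=\frac{a(a-1)\cdots(a-k+1)}{k!}$. *)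

(* Defs.v *)
From HB Require Import structures.
From mathcomp Require Import all_boot all_order all_algebra.
(* The notations of mpoly clash with those of mathcomp-analysis. *)
From mathcomp.multinomials Require Import -(notations) mpoly.
From mathcomp Require Import all_classical all_reals all_analysis.
Set Implicit Arguments.
Unset Strict Implicit.
Unset Printing Implicit Defensive.
Import Order.TTheory GRing.Theory Num.Theory.
Import numFieldNormedType.Exports.
Local Open Scope classical_set_scope.
Local Open Scope ring_scope.

(* Row vectors carry the product sigma-algebra, as tuples do in the library;
   over the reals it is the Borel sigma-algebra of R^n. *)
Section measurable_rV.
Context {d : measure_display} {T : measurableType d}.
Variable n : nat.

Let coords : 'I_n -> 'rV[T]_n -> T := fun i v => v ord0 i.

Let rV_set0 : g_sigma_preimage coords set0.
Proof. exact: sigma_algebra0. Qed.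

Let rV_setC A : g_sigma_preimage coords A -> g_sigma_preimage coords (~` A).
Proof. exact: sigma_algebraC. Qed.

Let rV_bigcup (F : _^nat) : (forall i, g_sigma_preimage coords (F i)) ->
  g_sigma_preimage coords (\bigcup_i (F i)).
Proof. exact: sigma_algebra_bigcup. Qed.

HB.instance Definition _ := @isMeasurable.Build (measure_tuple_display d)
  'rV[T]_n (g_sigma_preimage coords) rV_set0 rV_setC rV_bigcup.
End measurable_rV.


Section rV_cons.
Context {R : realType}.
Variable n : nat.

Definition rV_cons (u : measurableTypeR R * 'rV[R]_n) : 'rV[R]_n.+1 :=
  row_mx (const_mx u.1 : 'rV[R]_1) u.2.

Definition rV_uncons (v : 'rV[R]_n.+1) : measurableTypeR R * 'rV[R]_n :=
  (v ord0 ord0, rsubmx (v : 'rV[R]_(1 + n))).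

Lemma rV_consK : cancel rV_cons rV_uncons.
Proof.
move=> [x v]; rewrite /rV_uncons /rV_cons row_mxKr; congr pair.
rewrite (_ : ord0 = lshift n (ord0 : 'I_1)); last exact: val_inj.
by rewrite (@row_mxEl _ 1 1 n) mxE.
Qed.

Lemma rV_unconsK : cancel rV_uncons rV_cons.
Proof.
move=> v; rewrite /rV_uncons /rV_cons /=.
rewrite (_ : const_mx _ = lsubmx (v : 'rV[R]_(1 + n))) ?hsubmxK//.
by apply/rowP => i; rewrite !mxE; congr (v _ _); apply: val_inj; rewrite ord1.
Qed.

End rV_cons.

Lemma measurable_fun_rV d (T : measurableType d) (R : realType) n
    (f : T -> 'rV[R]_n) :
  (forall i, measurable_fun [set: T] (fun x => f x ord0 i)) ->
  measurable_fun [set: T] f.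
Proof.
move=> mf _ A mA; rewrite setTI.
pose c (i : 'I_n) (v : 'rV[R]_n) := v ord0 i.
have : preimage_set_system [set: T] f (g_sigma_preimage c) (f @^-1` A).
  by exists A => //; rewrite setTI.
rewrite -g_sigma_preimage_comp; apply: smallest_sub.
  exact: sigma_algebra_measurable.
elim/big_ind: _ => //; first by move=> B C ? ?; rewrite subUset; split.
by move=> i _ _ [B mB <-]; exact: mf.
Qed.

Lemma measurable_coord (R : realType) n (i : 'I_n) :
  measurable_fun [set: 'rV[R]_n] (fun v => v ord0 i).
Proof.
move=> _ B mB; apply: sub_sigma_algebra; rewrite -bigcup_seq /=.
by exists i; [rewrite /= mem_index_enum|exists B].
Qed.

Lemma measurable_rV_cons (R : realType) n :
  measurable_fun setT (@rV_cons R n).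
Proof.
apply: measurable_fun_rV => i.
case: (@split_ordP 1 n i) => j ->.
  rewrite (_ : (fun _ => _) = fst); first exact: measurable_fst.
  by apply/funext => u; rewrite (@row_mxEl _ 1 1 n) mxE.
rewrite (_ : (fun _ => _) = (fun v : 'rV[R]_n => v ord0 j) \o snd).
  by apply: measurableT_comp; [exact: measurable_coord|exact: measurable_snd].
by apply/funext => u; rewrite (@row_mxEr _ 1 1 n).
Qed.

Lemma measurable_rV_uncons (R : realType) n :
  measurable_fun setT (@rV_uncons R n).
Proof.
apply/measurable_fun_pairP; split; first exact: measurable_coord.
apply: measurable_fun_rV => i.
rewrite (_ : (fun _ => _) = fun v : 'rV_n.+1 => v ord0 (rshift 1 i)).
  exact: measurable_coord.
by apply/funext => v; rewrite /= mxE.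
Qed.

Section lebesgue_rV.
Context {R : realType}.
Local Open Scope ereal_scope.

Section step.
Variables (n : nat) (m : {sigma_finite_measure set 'rV[R]_n -> \bar R}).

Definition lebesgue_rVS : set 'rV[R]_n.+1 -> \bar R :=
  pushforward ((@lebesgue_measure R) \x m) (@rV_cons R n).

Let mcons := @measurable_rV_cons R n.

Let lebesgue_rVS0 : lebesgue_rVS set0 = 0.
Proof. by rewrite /lebesgue_rVS /pushforward preimage_set0 measure0. Qed.

Let lebesgue_rVS_ge0 A : 0 <= lebesgue_rVS A.
Proof. exact: measure_ge0. Qed.

Let lebesgue_rVS_sigma_additive : semi_sigma_additive lebesgue_rVS.
Proof. exact: measure_semi_sigma_additive. Qed.

HB.instance Definition _ := isMeasure.Build _ _ _ lebesgue_rVS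
  lebesgue_rVS0 lebesgue_rVS_ge0 lebesgue_rVS_sigma_additive.

Let lebesgue_rVS_sigma_finite : sigma_finite setT lebesgue_rVS.
Proof.
have /sigma_finiteP[F [FT ndF Foo]] := sigma_finiteT (@lebesgue_measure R).
have /sigma_finiteP[G [GT ndG Goo]] := sigma_finiteT m.
exists (fun k => @rV_uncons R n @^-1` (F k `*` G k)).
  rewrite -preimage_bigcup (_ : \bigcup_k _ = setT) ?preimage_setT//.
  rewrite -setXTT FT GT predeqE => -[x y]; split.
    by move=> [k _ []/= ? ?]; split; exists k.
  move=> [/= [k _ Fx] [l _ Gy]]; exists (maxn k l) => //; split.
  - by move: x Fx; exact/subsetPset/ndF/leq_maxl.
  - by move: y Gy; exact/subsetPset/ndG/leq_maxr.
move=> k; have [mF Fk] := Foo k; have [mG Gk] := Goo k; split.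
  rewrite -[X in measurable X]setTI; apply: measurable_rV_uncons => //.
  exact: measurableX.
rewrite /lebesgue_rVS /pushforward -comp_preimage.
rewrite (_ : _ \o _ = id); last by apply/funext => u /=; rewrite rV_consK.
by rewrite preimage_id product_measure1E// lte_mul_pinfty// ge0_fin_numE.
Qed.

HB.instance Definition _ := Measure_isSigmaFinite.Build _ _ _ lebesgue_rVS
  lebesgue_rVS_sigma_finite.

End step.

(* n-fold product of the one-dimensional Lebesgue measure; 'rV_0 is a point. *)
Fixpoint lebesgue_rV n : {sigma_finite_measure set 'rV[R]_n -> \bar R} :=
  match n with
  | 0 => \d_(0%R : 'rV[R]_0)
  | n'.+1 => lebesgue_rVS (lebesgue_rV n')
  end.

Lemma lebesgue_rV_box n (A : 'I_n -> set R) :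
  (forall i, measurable (A i)) ->
  lebesgue_rV n [set v | forall i, A i (v ord0 i)] =
  \prod_(i < n) lebesgue_measure (A i).
Proof.
elim: n A => [|n IH] A mA.
  by rewrite big_ord0 /= diracE mem_set//= => -[].
rewrite big_ord_recl -IH//= /lebesgue_rVS /pushforward.
have mB : measurable [set v : 'rV[R]_n | forall i, A (lift ord0 i) (v ord0 i)].
  rewrite (_ : mkset _ = \bigcap_(i in [set: 'I_n])
      ((fun v : 'rV[R]_n => v ord0 i) @^-1` A (lift ord0 i))).
    apply: fin_bigcap_measurable => // i _; rewrite -[X in measurable X]setTI.
    by apply: measurable_coord => //; exact: mA.
  by apply/seteqP; split=> v /= Av i; [move=> _|]; exact: Av.
rewrite -product_measure1E//; last exact: mA.
have E0 (u : measurableTypeR R * 'rV[R]_n) : rV_cons u ord0 ord0 = u.1.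
  by rewrite -[in RHS](rV_consK u).
have ES (u : measurableTypeR R * 'rV[R]_n) i :
    rV_cons u ord0 (lift ord0 i) = u.2 ord0 i.
  rewrite (_ : lift ord0 i = rshift 1 i); last exact: val_inj.
  by rewrite (@row_mxEr _ 1 1 n).
congr (_ _); apply/seteqP; split=> [u /= Au|u /= [Au0 AuS] i].
  split=> [|i]; first by rewrite -E0; exact: Au.
  by rewrite -ES; exact: Au.
by have [j ->|->] := unliftP ord0 i; rewrite ?E0 ?ES.
Qed.

End lebesgue_rV.

Section euclidean.
Context {R : realType} {p : nat}.
Implicit Types (x c : 'rV[R]_p) (A F S : set 'rV[R]_p).

(* The norm `|x| that the library puts on 'rV[R]_p is the sup norm. *)
Definition enorm x : R := Num.sqrt (\sum_(i < p) x ord0 i ^+ 2).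

Definition dist_set x A : R := inf [set enorm (x - y) | y in A].

Definition closed_eball c (rho : R) : set 'rV[R]_p :=
  [set y | enorm (y - c) <= rho].

Definition boundary S : set 'rV[R]_p := closure S `\` S°.

Definition rolls_inside (rho : R) F :=
  forall x, F x ->
    exists c, closed_eball c rho x /\ closed_eball c rho `<=` F.

Definition rolls_outside (rho : R) F := rolls_inside rho (closure (~` F)).

(* Extended real, hence +oo when no point of S is at distance at least delta
   from the boundary. *)
Definition inf_at_depth S (w : 'rV[R]_p -> R) (delta : R) : \bar R :=
  ereal_inf [set (w x)%:E | x in
    [set x | S x /\ delta <= dist_set x (boundary S)]].

(* The measurable sets of 'rV[R]_p are the Borel sets, whereas a density need
   only be Lebesgue measurable, i.e. almost everywhere equal on S to a Borel
   function g. *)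
Definition has_density_on (mu : set 'rV[R]_p -> \bar R) S
    (w : 'rV[R]_p -> R) :=
  exists g : 'rV[R]_p -> R,
    [/\ measurable_fun S g,
        {ae lebesgue_rV p, forall x, S x -> w x = g x} &
        forall A, measurable A ->
          mu A = (\int[lebesgue_rV p]_(x in A `&` S) (g x)%:E)%E].

End euclidean.

Section christoffel_darboux.
Context {R : realType} {p : nat}.

Definition peval (P : mpoly p R) (x : 'rV[R]_p) : R :=
  meval (fun i => x ord0 i) P.

(* mmeasure mdeg P, displayed as msize P in mpoly, is the total degree plus
   one, and 0 for the zero polynomial. *)
Definition poly_deg_le (d : nat) : set (mpoly p R) :=
  [set P | (mmeasure mdeg P <= d.+1)%N].

(* kappa(x, .) belongs to the space of polynomials of degree at most d and
   represents the evaluation at x for the inner product of L^2(mu). *)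
Definition is_CD_kernel (mu : probability 'rV[R]_p R) (d : nat)
    (kappa : 'rV[R]_p -> 'rV[R]_p -> R) :=
  forall x,
    (exists2 Q, poly_deg_le d Q & forall y, kappa x y = peval Q y) /\
    (forall P, poly_deg_le d P ->
       \int[mu]_y (peval P y * kappa x y) = peval P x).

Lemma is_CD_kernel_unique mu d k1 k2 :
  is_CD_kernel mu d k1 -> is_CD_kernel mu d k2 -> forall x y, k1 x y = k2 x y.
Proof.
have swap a b : is_CD_kernel mu d a -> is_CD_kernel mu d b ->
    forall x y, a x y = b y x.
  move=> ha hb x y.
  have [[P dP aP] ra] := ha x; have [[Q dQ bQ] rb] := hb y.
  rewrite aP -rb// bQ -ra//; apply: eq_Rintegral => z _.
  by rewrite aP bQ mulrC.
by move=> h1 h2 x y; rewrite (swap _ _ h1 h1) (swap _ _ h1 h2).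
Qed.

End christoffel_darboux.

Section constants.
Context {R : realType}.

(* The defining integral converges only for 0 < a. *)
Definition Gamma (a : R) : R :=
  \int[lebesgue_measure]_(t in `]0, +oo[) (t `^ (a - 1) * expR (- t)).

(* Surface area of the unit sphere of R^(p+1), of dimension p. *)
Definition omega (p : nat) : R :=
  2 * pi `^ ((p%:R + 1) / 2) / Gamma ((p%:R + 1) / 2).

Definition cgamma (p : nat) (r : R) : R :=
  Gamma (p%:R / 2 + r + 1) / (pi `^ (p%:R / 2) * Gamma (r + 1)).

Definition gbinom (a : R) (k : nat) : R :=
  (\prod_(i < k) (a - i%:R)) / k`!%:R.

(* Dimension of the space of polynomials of degree at most d in p variables. *)
Definition dim_poly (p d : nat) : nat := 'C(d + p, d).

End constants.

(* Main.v *)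
Require Import Defs.
From mathcomp Require Import all_boot all_order all_algebra.
From mathcomp.multinomials Require Import -(notations) mpoly.
From mathcomp Require Import ring lra zify.
From mathcomp Require Import all_classical all_reals all_analysis.
From mathcomp Require Import measurable_realfun.
Import Order.TTheory GRing.Theory Num.Theory.
Import numFieldNormedType.Exports.
Local Open Scope classical_set_scope.
Local Open Scope ring_scope.
Set Implicit Arguments.
Unset Strict Implicit.
Unset Printing Implicit Defensive.

(* By the reproducing property, it suffices to bound P(x)^2 by M times the
   integral of P^2 dmu for every polynomial P of degree at most d and x in S.
   A point x of a ball of radius rho inside S also lies on the boundary of a
   ball B of radius rho/2 inside that ball, on which the density is at least
   C (rho/4)^r (1 - |u|^2)^r, u being the coordinate that makes B the unit
   ball; so the case of points deep inside S needs no separate treatment, and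
   M is the second summand of the bound alone.

   After a reflection, x is the first basis vector e of the unit ball. Averaging
   P over the slice y_1 = t gives a polynomial Q of degree at most d in t, since
   odd monomials vanish and the slice has squared radius 1 - t^2, with
   Q(1) = P(e). By Jensen's inequality this reduces the bound to polynomials on
   [-1, 1] with the weight (1 - t^2)^(r + (p-1)/2), whose reproducing kernel at
   the endpoint 1 is computed from the Gegenbauer polynomials. *)

(** * Gegenbauer polynomials and the reproducing kernel at an endpoint *)

(** Placing x on the sphere that bounds B makes the reduction to one variable exact at the point of
    interest: the slice y_1 = t shrinks to the single point e at t = 1, so the average Q takes there
    the value of P itself.

    The exponent r + (p-1)/2 adds the exponent of the weight to that of the Jacobian of rescaling a
    (p-1)-dimensional slice to the unit ball. It belongs to the Gegenbauer parameter a/2 with a = 2r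
    + p, and this a is what appears in the two binomial coefficients of the bound.

    The other constants are geometric. The factor c_r is the reciprocal of the integral of (1 -
    |u|^2)^r over the unit ball. A point of B has depth at least (rho/2)(1 - |u|), and 1 - |u| >= (1
    - |u|^2)/2 inside B; this gives (rho/4)^r, hence the factor 4^r. Rescaling B to the unit ball
    contributes (rho/2)^(-p), hence the factor 2^p.

    The kernel at 1 is found algebraically, from an abstract functional that satisfies one
    integration by parts identity. The squared norms of the Gegenbauer polynomials are never
    computed. *)

Section gegenbauer.
Context {R : realType}.
Variable a : R.
Hypothesis a_gt0 : 0 < a.

(* gegen n is the Gegenbauer polynomial of parameter a / 2 normalized to take
   the value 1 at 1; the pairs make the three-term recursion structural. *)
Fixpoint gegen_pair (n : nat) : {poly R} * {poly R} :=
  if n is m.+1 then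
    let: (f, g) := gegen_pair m in
    (g, (m.+1%:R + a)^-1 *:
        ((2 * m.+1%:R + a) *: ('X * g) - m.+1%:R *: f))
  else (1, 'X).

Definition gegen n := (gegen_pair n).1.

Lemma gegen0 : gegen 0 = 1. Proof. by []. Qed.
Lemma gegen1 : gegen 1 = 'X. Proof. by []. Qed.

Lemma gegen_rec n : (n.+1%:R + a) *: gegen n.+2 =
  (2 * n.+1%:R + a) *: ('X * gegen n.+1) - n.+1%:R *: gegen n.
Proof.
have h : n.+1%:R + a != 0 by rewrite gt_eqF// addr_gt0.
rewrite /gegen /=; case: (gegen_pair n) => f g /=.
by rewrite scalerA mulfV// scale1r.
Qed.

Lemma gegen_at1 n : (gegen n).[1] = 1.
Proof.
suff: (gegen n).[1] = 1 /\ (gegen n.+1).[1] = 1 by case.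
elim: n => [|n [h1 h2]]; first by rewrite gegen0 gegen1 hornerC hornerX.
split=> //; have h : n.+1%:R + a != 0 by rewrite gt_eqF// addr_gt0.
have := congr1 (horner^~ 1) (gegen_rec n).
rewrite !(hornerZ, hornerD, hornerN, hornerM, hornerX) h1 h2 => e; apply: (mulfI h); rewrite e.
ring.
Qed.

Lemma size_gegen n : (size (gegen n) <= n.+1)%N.
Proof.
suff: (size (gegen n) <= n.+1)%N /\ (size (gegen n.+1) <= n.+2)%N by case.
elim: n => [|n [h1 h2]]; first by rewrite gegen0 gegen1 size_poly1 size_polyX.
split=> //; have h : n.+1%:R + a != 0 by rewrite gt_eqF// addr_gt0.
rewrite -(size_scale _ h) gegen_rec (leq_trans (size_polyD _ _))// geq_max.
apply/andP; split.
  rewrite (leq_trans (size_scale_leq _ _))//.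
  by rewrite (leq_trans (size_polyMleq _ _))// size_polyX.
rewrite size_polyN (leq_trans (size_scale_leq _ _))//.
by rewrite (leq_trans h1)// ltnW.
Qed.

Lemma gegen_deriv n : (1 - 'X^2) * (gegen n.+1)^`() =
  n.+1%:R *: (gegen n - 'X * gegen n.+1).
Proof.
(* The second formula is carried along because differentiating the recurrence for [gegen n.+2]
   brings in the derivatives of both [gegen n.+1] and [gegen n]. *)
suff: (1 - 'X^2) * (gegen n.+1)^`() =
    n.+1%:R *: (gegen n - 'X * gegen n.+1) /\
  (1 - 'X^2) * (gegen n)^`() =
    (n%:R + a) *: ('X * gegen n - gegen n.+1) by case.
elim: n => [|n [hA hB]].
  rewrite gegen0 gegen1 derivX derivC !mulr1 mulr0 subrr scaler0.
  by rewrite scale1r -expr2.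
have h : n.+1%:R + a != 0 by rewrite gt_eqF// addr_gt0.
have B : (1 - 'X^2) * (gegen n.+1)^`() =
    (n.+1%:R + a) *: ('X * gegen n.+1 - gegen n.+2).
  rewrite scalerBr gegen_rec hA -!mul_polyC !rmorphE/=; ring.
split=> //.
apply: (scalerI h); rewrite scalerAr -derivZ gegen_rec.
rewrite !(derivB, derivZ, derivM, derivX).
transitivity ((2 * n.+1%:R + a) *: ((1 - 'X^2) * gegen n.+1 +
  'X * ((1 - 'X^2) * (gegen n.+1)^`())) -
  n.+1%:R *: ((1 - 'X^2) * (gegen n)^`())).
  rewrite -!mul_polyC; ring.
rewrite hA hB.
have -> : (n.+1%:R + a) *: (n.+2%:R *: (gegen n.+1 - 'X * gegen n.+2)) =
    n.+2%:R *: ((n.+1%:R + a) *: gegen n.+1 -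
      'X * ((n.+1%:R + a) *: gegen n.+2)).
  by rewrite -!mul_polyC; ring.
rewrite gegen_rec -!mul_polyC.
rewrite (_ : n.+2%:R = n%:R + 2); last by rewrite -natr1 -natr1; ring.
rewrite (_ : n.+1%:R = n%:R + 1); last by rewrite -natr1; ring.
rewrite !rmorphE/=; ring.
Qed.

Section functional.
(** [E] stands for integration against (1 - t^2)^b on [-1, 1] with a = 2b + 1. The identity [E_ibp]
    then says that the derivative of (1 - t^2)^(b+1) f(t) has integral zero. *)
Variable E : {poly R} -> R.
Hypothesis E_linear : forall c (f g : {poly R}), E (c *: f + g) = c * E f + E g.
Hypothesis E_ibp : forall f : {poly R},
  E ((1 - 'X^2) * f^`()) = (a + 1) * E ('X * f).
Hypothesis E_ge0 : forall f : {poly R}, 0 <= E (f ^+ 2).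

Let E0 : E 0 = 0.
Proof.
by have := E_linear (-1) 0 0; rewrite scaler0 addr0 mulN1r addNr.
Qed.

Let EZ c f : E (c *: f) = c * E f.
Proof. by have := E_linear c f 0; rewrite E0 !addr0. Qed.

Let ED f g : E (f + g) = E f + E g.
Proof. by have := E_linear 1 f g; rewrite scale1r mul1r. Qed.

Let EB f g : E (f - g) = E f - E g.
Proof. by rewrite ED -scaleN1r EZ mulN1r. Qed.

(** Applying [E] to [gegen_deriv] and to the recurrence gives two relations through E(X G_(m+1)),
    and these carry E(G_m) = 0 over to E(G_(m+2)) = 0. At m = 0, where E(G_0) need not vanish, the
    factor m does the work instead. *)
Let E_gegen n : E (gegen n.+1) = 0.
Proof.
have step m : (m.+1%:R + a) * E (gegen m.+2) = m%:R * E ('X * gegen m.+1) /\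
    m.+1%:R * E (gegen m) = (m.+1%:R + a + 1) * E ('X * gegen m.+1).
  have e1 := E_ibp (gegen m.+1).
  have e2 := congr1 E (gegen_rec m).
  rewrite gegen_deriv EZ EB in e1; rewrite EB !EZ in e2.
  by move: e1 e2; rewrite -natr1; split; lra.
have nz m : m.+1%:R + a != 0 by rewrite gt_eqF// addr_gt0.
have nz1 m : m.+1%:R + a + 1 != 0 by rewrite gt_eqF// !addr_gt0.
suff: E (gegen n.+1) = 0 /\ E (gegen n.+2) = 0 by case.
elim: n => [|n [h1 h2]].
  split.
    have := E_ibp 1; rewrite derivC !mulr0 mulr1 E0 gegen1 => /esym/eqP.
    by rewrite mulf_eq0 gt_eqF ?addr_gt0//= => /eqP.
  have [/eqP h _] := step 0%N.
  by move: h; rewrite mul0r mulf_eq0 (negPf (nz _)) => /eqP.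
split=> //; have [h3 /esym/eqP] := step n.+1.
rewrite h1 mulr0 mulf_eq0 (negPf (nz1 _))/= => /eqP h4.
by move/eqP: h3; rewrite h4 mulr0 mulf_eq0 (negPf (nz _)) => /eqP.
Qed.

(** The recurrence trades one factor X for a shift of the index by one in either direction, which
    keeps the index above the exponent. *)
Let E_gegenX m n : (m < n)%N -> E ('X^m * gegen n) = 0.
Proof.
elim: m n => [|m IH] [//|n] mn; first by rewrite expr0 mul1r E_gegen.
have h : 2 * n.+1%:R + a != 0 by rewrite gt_eqF// addr_gt0// mulr_gt0.
apply: (mulfI h); rewrite mulr0 -EZ exprSr -mulrA scalerAr.
have -> : (2 * n.+1%:R + a) *: ('X * gegen n.+1) =
    (n.+1%:R + a) *: gegen n.+2 + n.+1%:R *: gegen n.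
  by rewrite gegen_rec subrK.
rewrite mulrDr -!scalerAr ED !EZ !IH// ?mulr0 ?addr0//.
by rewrite ltnS ltnW// ltnW.
Qed.

Let E_gegen_orthogonal (f : {poly R}) n : (size f <= n)%N -> E (f * gegen n) = 0.
Proof.
move=> fn; rewrite -[f]coefK poly_def mulr_suml.
elim/big_rec : _ => [//|i y _ yE].
by rewrite ED yE -scalerAl EZ E_gegenX ?mulr0 ?addr0// (leq_trans _ fn).
Qed.

(** The Pochhammer quotient (a+1)_n / n!, which is the binomial coefficient of a + n over n
    ([gbinom_rising_ratio]). *)
Definition rising_ratio n : R := \prod_(i < n) ((a + 1 + i%:R) / i.+1%:R).

Lemma rising_ratioS n :
  rising_ratio n.+1 = rising_ratio n * ((a + 1 + n%:R) / n.+1%:R).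
Proof. by rewrite /rising_ratio big_ord_recr. Qed.

Lemma rising_ratio_gt0 n : 0 < rising_ratio n.
Proof. by apply: prodr_gt0 => i _; rewrite divr_gt0// ltr_wpDr// addr_gt0. Qed.

(* Reproducing kernel at 1 of the polynomials of degree at most d. *)
Fixpoint endpoint_kernel d : {poly R} :=
  if d is n.+1 then endpoint_kernel n +
    ((2 * n.+1%:R + a) / n.+1%:R * rising_ratio n) *: gegen n.+1
  else 1.

(* Christoffel-Darboux formula at 1. *)
Lemma endpoint_kernelM d : (1 - 'X) * endpoint_kernel d =
  rising_ratio d *: (gegen d - gegen d.+1).
Proof.
elim: d => [|d IH]; first by rewrite /rising_ratio big_ord0 scale1r mulr1.
rewrite /= mulrDr IH rising_ratioS.
have -> : (1 - 'X) *
      (((2 * d.+1%:R + a) / d.+1%:R * rising_ratio d) *: gegen d.+1) =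
    (rising_ratio d / d.+1%:R) *: ((2 * d.+1%:R + a) *: gegen d.+1 -
      (2 * d.+1%:R + a) *: ('X * gegen d.+1)).
  by rewrite -!mul_polyC !rmorphM/=; ring.
have -> : (2 * d.+1%:R + a) *: ('X * gegen d.+1) =
    (d.+1%:R + a) *: gegen d.+2 + d.+1%:R *: gegen d.
  by rewrite gegen_rec subrK.
have -> : rising_ratio d *: (gegen d - gegen d.+1) =
    (rising_ratio d / d.+1%:R) *: (d.+1%:R *: (gegen d - gegen d.+1)).
  by rewrite scalerA divfK.
have -> : rising_ratio d * ((a + 1 + d%:R) / d.+1%:R) =
    rising_ratio d / d.+1%:R * (d.+1%:R + a).
  by rewrite -natr1; ring.
rewrite -!mul_polyC !rmorphM/= !rmorphD/=; ring.
Qed.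

Lemma endpoint_kernel_at1 d : (endpoint_kernel d).[1] =
  rising_ratio d * ((a + 1 + 2 * d%:R) / (a + 1)).
Proof.
have a1 : a + 1 != 0 by rewrite gt_eqF// addr_gt0.
elim: d => [|d IH].
  by rewrite /= hornerC /rising_ratio big_ord0 mulr0 addr0 divff ?mulr1.
rewrite /= hornerD hornerZ IH gegen_at1 rising_ratioS mulr1.
have : d.+1%:R != 0 :> R by [].
rewrite -natr1 => d1; field.
by rewrite d1 a1.
Qed.

Lemma endpoint_kernel_at1_gt0 d : 0 < (endpoint_kernel d).[1].
Proof.
rewrite endpoint_kernel_at1; apply: mulr_gt0; first exact: rising_ratio_gt0.
apply: divr_gt0; last exact: addr_gt0.
by rewrite ltr_wpDr ?mulr_ge0// addr_gt0.
Qed.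

Lemma size_endpoint_kernel d : (size (endpoint_kernel d) <= d.+1)%N.
Proof.
elim: d => [|d IH]; first by rewrite size_poly1.
rewrite (leq_trans (size_polyD _ _))// geq_max (leq_trans IH)//=.
by rewrite (leq_trans (size_scale_leq _ _))// size_gegen.
Qed.

(** Write q = q(1) + f (X - 1) with f of degree below d. By the Christoffel-Darboux formula the
    factor X - 1 turns the kernel into a multiple of G_d - G_(d+1), which is orthogonal to f. The
    constant q(1) only meets the term G_0 of the kernel. [E] is not normalized, hence the factor
    [E 1]. *)
Lemma endpoint_kernel_reproducing d (q : {poly R}) : (size q <= d.+1)%N ->
  E (endpoint_kernel d * q) = q.[1] * E 1.
Proof.
move=> qd; have [f fE] : exists f, q - q.[1]%:P = f * ('X - 1%:P).
  by apply/factor_theorem; rewrite rootE !hornerE subrr.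
have fd : (size f <= d)%N.
  have [->|f0] := eqVneq f 0; first by rewrite size_poly0.
  have := size_Mmonic f0 (monicXsubC 1); rewrite -fE size_XsubC addn2/= => fE'.
  rewrite -ltnS -fE' (leq_trans (size_polyD _ _))// geq_max qd size_polyN.
  by rewrite (leq_trans (size_polyC_leq1 _)).
have -> : q = q.[1]%:P + f * ('X - 1%:P) by rewrite -fE addrC subrK.
rewrite mulrDr ED.
have -> : endpoint_kernel d * (f * ('X - 1%:P)) =
    - (f * ((1 - 'X) * endpoint_kernel d)) by rewrite rmorph1; ring.
rewrite endpoint_kernelM -scalerAr -scaleN1r !EZ mulrBr EB.
rewrite !E_gegen_orthogonal ?(leq_trans fd)// subrr !mulr0 addr0.
rewrite hornerD hornerC hornerM hornerXsubC subrr mulr0 addr0.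
rewrite mulrC mul_polyC EZ; congr (_ * _).
by elim: d {qd fd} => [//|d IH] /=; rewrite ED EZ IH E_gegen mulr0 addr0.
Qed.

(** Cauchy-Schwarz inequality for q and the kernel k: the reproducing property evaluates both E(k q)
    and E(k k), and [s] is the coefficient of the projection of q on k. *)
Lemma endpoint_kernel_bound d (q : {poly R}) : (size q <= d.+1)%N ->
  q.[1] ^+ 2 * E 1 <= (endpoint_kernel d).[1] * E (q ^+ 2).
Proof.
move=> qd; have k0 := endpoint_kernel_at1_gt0 d.
set k := endpoint_kernel d in k0 *; set s := q.[1] / k.[1].
have := E_ge0 (q - s *: k).
have -> : (q - s *: k) ^+ 2 = q ^+ 2 - (2 * s) *: (k * q) + s ^+ 2 *: (k * k).
  by rewrite -!mul_polyC !rmorphM/= ?rmorphXn/=; ring.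
rewrite ED EB !EZ !endpoint_kernel_reproducing ?size_endpoint_kernel//.
rewrite -/k => h; rewrite -subr_ge0.
have -> : k.[1] * E (q ^+ 2) - q.[1] ^+ 2 * E 1 = k.[1] *
    (E (q ^+ 2) - 2 * s * (q.[1] * E 1) + s ^+ 2 * (k.[1] * E 1)).
  by rewrite /s; field; rewrite gt_eqF.
by apply: mulr_ge0 => //; exact: ltW.
Qed.

End functional.

Lemma gbinom_rising_ratio d : gbinom (a + d%:R) d = rising_ratio d.
Proof.
elim: d => [|d IH]; first by rewrite /gbinom /rising_ratio !big_ord0 divr1.
rewrite rising_ratioS -IH /gbinom big_ord_recl subr0.
rewrite (eq_bigr (fun i : 'I_d => a + d%:R - i%:R)); last first.
  by move=> i _; rewrite /= /bump leq0n add1n -!natr1; ring.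
rewrite factS natrM; set p := \prod_(_ < d) _.
have : d.+1%:R != 0 :> R by [].
have : d`!%:R != 0 :> R by rewrite pnatr_eq0 -lt0n fact_gt0.
rewrite -natr1 => f0 d1; field.
by rewrite d1 f0.
Qed.

End gegenbauer.

(** Raising a by one multiplies the rising ratio by (a + 1 + d) / (a + 1), and 2 (a + 1 + d) - (a +
    1) = a + 1 + 2d is the numerator in [endpoint_kernel_at1]. *)
Lemma endpoint_kernel_gbinom (R : realType) (a : R) d : 0 < a ->
  (endpoint_kernel a d).[1] =
  2 * gbinom (a + 1 + d%:R) d - gbinom (a + d%:R) d.
Proof.
move=> a0; rewrite endpoint_kernel_at1// !gbinom_rising_ratio.
have a1 : a + 1 != 0 by rewrite gt_eqF// addr_gt0.
have -> : rising_ratio (a + 1) d = rising_ratio a d * ((a + 1 + d%:R) / (a + 1)).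
  elim: d => [|d IH].
    by rewrite /rising_ratio !big_ord0 addr0 divff ?mulr1.
  rewrite !rising_ratioS IH.
  have : d.+1%:R != 0 :> R by [].
  rewrite -natr1 => d1; field.
  by rewrite d1 a1.
field => //.
Qed.

(** * Beta and Gamma integrals *)

Section change_of_variable.
Context {R : realType}.
Local Notation leb := (@lebesgue_measure R).

Lemma measurable_affine (c s : R) :
  measurable_fun [set: measurableTypeR R]
    (fun x : measurableTypeR R => (c + s * x : measurableTypeR R)).
Proof. by apply: measurable_funD => //; apply: measurable_funM. Qed.

(** By uniqueness of Lebesgue measure, intervals ]x, y] suffice. For s < 0 the preimage is closed at
    the other end, with the same length. *)
Lemma lebesgue_measure_affine (c s : R) (A : set (measurableTypeR R)) :
  s != 0 -> measurable A ->
  leb A = (`|s|%:E *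
    pushforward leb (fun x => (c + s * x)%R : measurableTypeR R) A)%E.
Proof.
move=> s0 mA; have s1 : 0 <= `|s| by [].
apply: (@lebesgue_measure_unique R (mscale (NngNum s1)
  (pushforward leb (fun x => (c + s * x)%R : measurableTypeR R)))) => //.
  exact: measurable_affine.
move=> ? _ [[x y] /= _ <-]; rewrite /mscale/= /pushforward.
rewrite lebesgue_measure_itv/= lte_fin.
have [s_lt0|s_gt0|/eqP] := ltgtP s 0; last by rewrite (negPf s0).
  have -> : (fun t => c + s * t) @^-1` `]x, y] =
      `[(y - c) / s, (x - c) / s[%classic.
    apply/seteqP; split => t /=; rewrite !in_itv/= ler_ndivrMr// ltr_ndivlMr//;
      by move=> /andP[? ?]; apply/andP; split; lra.
  rewrite lebesgue_measure_itv/= lte_fin ltr_ndivrMr// divfK// ltrD2r.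
  case: ifP => _; last by rewrite mule0.
  by rewrite ltr0_norm// -!EFinB -EFinM; congr EFin; field.
have -> : (fun t => c + s * t) @^-1` `]x, y] =
    `](x - c) / s, (y - c) / s]%classic.
  apply/seteqP; split => t /=; rewrite !in_itv/= ler_pdivlMr// ltr_pdivrMr//;
    by move=> /andP[? ?]; apply/andP; split; lra.
rewrite lebesgue_measure_itv/= lte_fin ltr_pdivrMr// divfK// ltrD2r.
case: ifP => _; last by rewrite mule0.
by rewrite gtr0_norm// -!EFinB -EFinM; congr EFin; field.
Qed.

Lemma integral_affine (c s : R) (f : R -> \bar R) : s != 0 ->
  measurable_fun [set: measurableTypeR R] f -> (forall x, 0 <= f x)%E ->
  (\int[leb]_x f x = `|s|%:E * \int[leb]_x f (c + s * x)%R)%E.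
Proof.
move=> s0 mf f0; have s1 : 0 <= `|s| by [].
rewrite (@eq_measure_integral _ _ _ _ (mscale (NngNum s1)
  (pushforward leb (fun x => (c + s * x)%R : measurableTypeR R)))) /=.
- exact: measurable_affine.
- move=> mp; rewrite ge0_integral_mscale//=; congr (_ * _)%E.
  by rewrite ge0_integral_pushforward//= => y _.
- by move=> mp A mA _; rewrite (lebesgue_measure_affine c s0).
Qed.

End change_of_variable.

Section beta_gamma.
Context {R : realType}.
Local Notation leb := (@lebesgue_measure R).

(** The truncation makes (1 - |x|^2)^r vanish off the open unit ball, also for r = 0, so that all
    weighted integrals can be taken over the whole space. *)
Definition pospow (r x : R) : R := if 0 < x then x `^ r else 0.

Lemma pospow_ge0 r x : 0 <= pospow r x.
Proof. by rewrite /pospow; case: ifP => // _; exact: powR_ge0. Qed.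

Lemma pospowE r x : 0 < x -> pospow r x = x `^ r.
Proof. by rewrite /pospow => ->. Qed.

Lemma pospow_le0 r x : x <= 0 -> pospow r x = 0.
Proof. by rewrite /pospow ltNge => ->. Qed.

Lemma pospowM r s x : 0 < s -> pospow r (s * x) = s `^ r * pospow r x.
Proof.
move=> s0; rewrite /pospow pmulr_rgt0//; case: ifP => [x0|_]; last by rewrite mulr0.
by rewrite powRM ?ltW.
Qed.

Lemma measurable_pospow r : measurable_fun [set: R] (pospow r).
Proof.
by apply: measurable_fun_ifT => //; exact: measurable_fun_ltr.
Qed.

Definition beta_integral (b : R) : \bar R :=
  \int[leb]_x (pospow b (1 - x ^+ 2))%:E.

(** Shifted by one from the usual argument: the value is Gamma(b + 1). Being extended real, it can
    enter Tonelli's theorem before finiteness is known. *)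
Definition gamma_integral (b : R) : \bar R :=
  \int[leb]_x (pospow b x * expR (- x))%:E.

Lemma beta_integral_ge0 b : (0 <= beta_integral b)%E.
Proof. by apply: integral_ge0 => x _; rewrite lee_fin pospow_ge0. Qed.

Lemma measurable_gamma_fun b :
  measurable_fun [set: measurableTypeR R]
    (fun x : measurableTypeR R => (pospow b x * expR (- x))%:E).
Proof.
apply/measurable_EFinP; apply: measurable_funM; first exact: measurable_pospow.
by apply: measurableT_comp.
Qed.

(* Both sides compute the integral of exp(-x^2-u) u^b over u > 0, where the
   right-hand side uses the coordinates x and v = x^2 + u. *)
Lemma beta_gamma_integral b :
  ((Num.sqrt pi)%:E * gamma_integral b =
   beta_integral b * gamma_integral (b + 2^-1))%E.
Proof.
pose h (xv : R * R) := (pospow b (xv.2 - xv.1 ^+ 2) * expR (- xv.2))%:E.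
have mh : measurable_fun [set: measurableTypeR R * measurableTypeR R] h.
  apply/measurable_EFinP; apply: measurable_funM.
    apply: measurableT_comp; first exact: measurable_pospow.
    by apply: measurable_funB => //; apply: measurable_funX.
  by apply: measurableT_comp => //; apply: measurableT_comp.
have h0 xv : (0 <= h xv)%E by rewrite lee_fin mulr_ge0 ?pospow_ge0 ?expR_ge0.
have := @fubini_tonelli _ _ _ _ _ leb leb h mh h0.
have -> : (\int[leb]_x \int[leb]_y h (x, y) =
    (Num.sqrt pi)%:E * gamma_integral b)%E.
  transitivity (\int[leb]_x ((gauss_fun x)%:E * gamma_integral b))%E.
    apply: eq_integral => x _.
    rewrite (integral_affine (x ^+ 2) (oner_neq0 R)).
    - rewrite normr1 mul1e.
      rewrite -ge0_integralZl//=; last 3 first.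
      + exact: measurable_gamma_fun.
      + by move=> y _; rewrite lee_fin mulr_ge0 ?pospow_ge0 ?expR_ge0.
      + by rewrite lee_fin gauss_fun_ge0.
      apply: eq_integral => y _; rewrite /h/= /gauss_fun -EFinM; congr EFin.
      by rewrite mul1r addrAC subrr add0r opprD expRD; ring.
    - exact: (measurableT_comp mh (pair1_measurable x)).
    - by move=> y.
  rewrite ge0_integralZr//.
  - by rewrite integralT_gauss.
  - by apply/measurable_EFinP; exact: measurable_gauss_fun.
  - by move=> x _; rewrite lee_fin gauss_fun_ge0.
  - by apply: integral_ge0 => x _; rewrite lee_fin mulr_ge0 ?pospow_ge0 ?expR_ge0.
move=> ->; rewrite /gamma_integral -ge0_integralZl//=.
- apply: eq_integral => v _.
  have [v0|v0] := ltP 0 v; last first.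
    rewrite pospow_le0// mul0r mule0; apply: integral0_eq => x _.
    by rewrite /h/= pospow_le0 ?mul0r// subr_le0 (le_trans v0)// sqr_ge0.
  have sv0 : Num.sqrt v != 0 by rewrite gt_eqF// sqrtr_gt0.
  rewrite (integral_affine 0 sv0); last 2 first.
  + exact: (measurableT_comp mh (pair2_measurable v)).
  + by move=> x.
  rewrite muleC /beta_integral -ge0_integralZr//=.
  + rewrite -ge0_integralZr//=.
    * apply: eq_integral => x _; rewrite /h/= -!EFinM; congr EFin.
      rewrite add0r exprMn sqr_sqrtr ?ltW// -[X in X - _]mulr1 -mulrBr.
      rewrite pospowM// (pospowE (b + _) v0) ger0_norm ?sqrtr_ge0//.
      rewrite powRD ?(gt_eqF v0) ?implybT// powR12_sqrt ?ltW//; ring.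
    * apply/measurable_EFinP; apply: measurableT_comp.
        exact: measurable_pospow.
      by apply: measurable_funB => //; apply: measurable_funX.
    * by move=> x _; rewrite lee_fin pospow_ge0.
    * by rewrite lee_fin mulr_ge0 ?pospow_ge0 ?expR_ge0.
  + apply: (measurableT_comp mh); apply: measurable_fun_pair => //.
    exact: measurable_affine.
- exact: measurable_gamma_fun.
- by move=> x _; rewrite lee_fin mulr_ge0 ?pospow_ge0 ?expR_ge0.
- exact: beta_integral_ge0.
Qed.

Lemma gamma_integral_gt0 (b : R) : 0 <= b -> (0 < gamma_integral b)%E.
Proof.
move=> b0; apply: (@lt_le_trans _ _ (\int[leb]_(x in `[1%R, 2%R]) (expR (- 2 : R))%:E)%E).
  rewrite integral_cst//= lebesgue_measure_itv/= lte_fin ltr1n.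
  by rewrite -EFinB -EFinM lte_fin mulr_gt0 ?expR_gt0//; lra.
apply: (@le_trans _ _ (\int[leb]_(x in `[1%R, 2%R])
    (pospow b x * expR (- x))%:E)%E).
  apply: ge0_le_integral => //=.
  - exact: measurable_funTS (measurable_gamma_fun b).
  - move=> x; rewrite in_itv/= => /andP[x1 x2].
    rewrite lee_fin pospowE ?(lt_le_trans _ x1)// -[leLHS]mul1r.
    apply: ler_pM; rewrite ?ler01 ?expR_ge0 ?ler_expR ?lerN2//.
    by rewrite -(powRr0 x); apply: ler_powR.
apply: ge0_subset_integral => //=; first exact: measurable_gamma_fun.
by move=> x _; rewrite lee_fin mulr_ge0 ?pospow_ge0 ?expR_ge0.
Qed.

Lemma gamma_integral_lty (b : R) : 0 <= b -> (gamma_integral b < +oo)%E.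
Proof.
move=> b0.
(* For b > 0, the inequality ln y <= y - 1 at y = x / (2b) gives x^b <= (2b/e)^b exp(x/2). The
   integrand is then at most 2K times the exponential density of rate 1/2. *)
have [K K0 pK] : exists2 K, 0 <= K & forall x, 0 < x -> x `^ b <= K * expR (x / 2).
  have [->|bn0] := eqVneq b 0.
    by exists 1 => // x x0; rewrite powRr0 mul1r -expR0 ler_expR divr_ge0 ?ltW.
  have b_gt0 : 0 < b by rewrite lt0r bn0.
  exists (expR (b * (ln (2 * b) - 1))); first exact: expR_ge0.
  move=> x x0; rewrite -expRD /powR gt_eqF// ler_expR.
  have xb : 0 < x / (2 * b) by rewrite divr_gt0// mulr_gt0.
  have : ln (x / (2 * b)) <= x / (2 * b) - 1.
    by have := @le_ln1Dx R (x / (2 * b) - 1); rewrite addrCA subrr addr0; apply; lra.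
  have e : ln x = ln (x / (2 * b)) + ln (2 * b).
    by rewrite -lnM ?posrE ?xb ?mulr_gt0// divfK// gt_eqF// mulr_gt0.
  move=> h; rewrite e.
  have -> : x / 2 = b * (x / (2 * b)) by field.
  by rewrite -mulrDr ler_pM2l//; lra.
apply: (@le_lt_trans _ _ (\int[leb]_x ((2 * K)%:E * (exponential_pdf 2^-1 x)%:E))%E).
  apply: ge0_le_integral => //=.
  - by move=> x _; rewrite lee_fin mulr_ge0 ?pospow_ge0 ?expR_ge0.
  - exact: measurable_gamma_fun.
  - apply/measurable_EFinP; apply: measurable_funM => //.
    exact: measurable_exponential_pdf.
  - move=> x _; rewrite -EFinM lee_fin.
    have [x0|x0] := ltP 0 x; last first.
      by rewrite pospow_le0// mul0r !mulr_ge0// exponential_pdf_ge0.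
    rewrite pospowE// exponential_pdfE ?(ltW x0)//.
    apply: (le_trans (ler_wpM2r (expR_ge0 _) (pK x x0))).
    rewrite -mulrA -expRD le_eqVlt; apply/orP; left; apply/eqP.
    rewrite (_ : x / 2 - x = - 2^-1 * x); last by field.
    by field.
rewrite ge0_integralZl//=.
- by rewrite integral_exponential_pdf// mule1 ltry.
- by apply/measurable_EFinP; exact: measurable_exponential_pdf.
- by move=> x _; rewrite lee_fin exponential_pdf_ge0.
- by rewrite lee_fin mulr_ge0.
Qed.

Lemma gamma_integralE (b : R) : 0 <= b -> gamma_integral b = (Gamma (b + 1))%:E.
Proof.
move=> b0; rewrite /Gamma /Rintegral.
rewrite (_ : (\int[leb]_(t in _) _)%E = gamma_integral b).
  rewrite fineK// ge0_fin_numE; last exact/ltW/gamma_integral_gt0.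
  exact: gamma_integral_lty.
rewrite integral_mkcond; apply: eq_integral => x _.
rewrite /patch; case: ifPn => [|].
  by rewrite inE/= in_itv/= andbT => x0; rewrite pospowE// addrK.
rewrite notin_setE/= in_itv/= andbT => /negP; rewrite -leNgt => x0.
by rewrite pospow_le0// mul0r.
Qed.

Lemma Gamma_gt0 (b : R) : 0 <= b -> 0 < Gamma (b + 1) :> R.
Proof.
by move=> b0; rewrite -lte_fin -gamma_integralE//; exact: gamma_integral_gt0.
Qed.

(** Finiteness comes with the value: an infinite beta integral times a positive Gamma value could
    not equal the finite left-hand side of [beta_gamma_integral]. *)
Lemma beta_integralE (b : R) : 0 <= b ->
  beta_integral b = (Num.sqrt pi * Gamma (b + 1) / Gamma (b + 2^-1 + 1))%:E.
Proof.
move=> b0; have b1 : 0 <= b + 2^-1 by rewrite addr_ge0.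
have G := Gamma_gt0 b1.
have := beta_gamma_integral b; rewrite !gamma_integralE//.
have := beta_integral_ge0 b; case: (beta_integral b) => [B| |]//= _.
- by rewrite -!EFinM => -[->]; rewrite mulfK// gt_eqF.
- by rewrite mulyr gtr0_sg// mul1e.
Qed.

End beta_gamma.

(** * Jacobi weights on [-1, 1] *)

Section jacobi.
Context {R : realType}.
Local Notation leb := (@lebesgue_measure R).

Lemma pospow_cvg0_left (b : R) : pospow b x @[x --> 0^'-] --> (0 : R).
Proof.
apply: cvg_near_cst; near=> x; apply: pospow_le0.
by apply: ltW; near: x; exact: nbhs_left_lt.
Unshelve. all: by end_near. Qed.

Lemma continuous_pospow (b : R) : 0 < b -> continuous (pospow b : R -> R).
Proof.
move=> b0 x; have [x0|x0|->] := ltgtP x 0.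
- rewrite /continuous_at pospow_le0 ?ltW//; apply: cvg_near_cst; near=> y.
  apply: pospow_le0; apply: ltW; near: y; exact: lt_nbhsl.
- have cx : {for x, continuous (fun y : R => y `^ b)}.
    apply/differentiable_continuous/derivable1_diffP.
    by apply: derivable_powR; rewrite in_itv/= andbT.
  rewrite /continuous_at pospowE//; apply: cvg_trans cx.
  apply: near_eq_cvg; near=> y; rewrite pospowE//; near: y; exact: lt_nbhsr.
- apply/left_right_continuousP; rewrite pospow_le0//; split.
    exact: pospow_cvg0_left.
  apply: cvg_trans (powR_cvg0 b0).
  apply: near_eq_cvg; near=> y; rewrite pospowE//.
Unshelve. all: by end_near. Qed.

Variable b : R.
Hypothesis b0 : 0 <= b.

(* Agrees with pospow b (1 - t^2) except at the endpoints when b = 0, where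
   continuity requires the value 1. *)
Let weight (t : R) : R := if b == 0 then 1 else pospow b (1 - t ^+ 2).

Let weightE t : -1 < t < 1 -> weight t = pospow b (1 - t ^+ 2).
Proof.
move=> /andP[t1 t2]; rewrite /weight; case: eqP => // ->.
rewrite pospowE ?powRr0//.
by rewrite subr_gt0; nra.
Qed.

Let weight_ge0 t : 0 <= weight t.
Proof. by rewrite /weight; case: ifP => // _; exact: pospow_ge0. Qed.

Let continuous_onem_sqr : continuous (fun t : R => 1 - t ^+ 2).
Proof.
move=> t; apply: cvgB; first exact: cvg_cst.
exact: exprn_continuous.
Qed.

Let continuous_pospow_comp c : 0 < c ->
  continuous (fun t : R => pospow c (1 - t ^+ 2)).
Proof.
move=> c0 t; apply: (@continuous_comp _ _ _ (fun t : R => 1 - t ^+ 2)).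
  exact: continuous_onem_sqr.
exact: continuous_pospow.
Qed.

Let continuous_weight : continuous weight.
Proof.
rewrite /weight; case: eqP => [_|/eqP bn0]; first exact: cst_continuous.
by apply: continuous_pospow_comp; rewrite lt0r bn0.
Qed.

Let continuous_fw (f : {poly R}) : continuous (fun t : R => f.[t] * weight t).
Proof.
move=> t; apply: cvgM; last exact: continuous_weight.
exact: continuous_horner.
Qed.

Definition jacobi_functional (f : {poly R}) : R :=
  \int[leb]_(t in `[-1, 1]) (f.[t] * weight t).

Let integrable_fw (f : {poly R}) :
  leb.-integrable `[-1, 1] (EFin \o (fun t : R => f.[t] * weight t)).
Proof.
apply: continuous_compact_integrable; first exact: segment_compact.
by apply: continuous_subspaceT; exact: continuous_fw.
Qed.

Lemma jacobi_functionalE f :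
  (\int[leb]_t (f.[t] * pospow b (1 - t ^+ 2))%:E)%E =
  (jacobi_functional f)%:E.
Proof.
rewrite /jacobi_functional /Rintegral fineK; last first.
  exact: integrable_fin_num (integrable_fw f).
(* Passing to the open interval removes the endpoints, where the two weights differ when b = 0. *)
rewrite integral_itv_bndoo; last first.
  apply: measurable_funTS; apply/measurable_EFinP.
  exact: continuous_measurable_fun.
rewrite [RHS]integral_mkcond; apply: eq_integral => t _.
rewrite /patch; case: ifPn => [|].
  by rewrite inE/= in_itv/= => t1; rewrite weightE.
rewrite notin_setE/= in_itv/= => t1; rewrite pospow_le0 ?mulr0//.
rewrite subr_le0 leNgt; apply/negP => t2; apply: t1.
by rewrite -ltr_norml -(ltr_pXn2r (n := 2)) ?nnegrE// expr1n real_normK ?num_real.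
Qed.

Lemma jacobi_functional_linear c (f g : {poly R}) :
  jacobi_functional (c *: f + g) =
  c * jacobi_functional f + jacobi_functional g.
Proof.
rewrite /jacobi_functional -RintegralZl//.
rewrite -RintegralD//=; last first.
  have := integrable_fw (c *: f); congr (_.-integrable _ _).
  by apply/funext => t /=; rewrite hornerZ mulrA.
by apply: eq_Rintegral => t _; rewrite hornerD hornerZ; ring.
Qed.

Lemma jacobi_functional_ge0 (f : {poly R}) : 0 <= jacobi_functional (f ^+ 2).
Proof.
apply: Rintegral_ge0 => t _.
by rewrite mulr_ge0// horner_exp sqr_ge0.
Qed.

Let jacobi_ibp0 (f : {poly R}) : jacobi_functional
  ((1 - 'X^2) * f^`() - (2 * b + 1 + 1) *: ('X * f)) = 0.
Proof.
(* [F] is a primitive of the integrand on the open interval. Since b + 1 > 0, it is continuous up to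
   the endpoints and vanishes there. *)
pose F (t : R) : R := pospow (b + 1) (1 - t ^+ 2) * f.[t].
have b1 : 0 < b + 1 by rewrite ltr_wpDl.
have cF : continuous F.
  move=> t; apply: cvgM; last exact: continuous_horner.
  exact: continuous_pospow_comp.
have dF (t : R) : -1 < t < 1 -> is_derive t (1 : R) F
    (((1 - 'X^2) * f^`() - (2 * b + 1 + 1) *: ('X * f)).[t] *
     pospow b (1 - t ^+ 2)).
  move=> /andP[t1 t2]; have t0 : 0 < 1 - t ^+ 2 by rewrite subr_gt0; nra.
  have dG : is_derive t (1 : R) (fun t : R => (1 - t ^+ 2) `^ (b + 1) * f.[t])
      (((1 - 'X^2) * f^`() - (2 * b + 1 + 1) *: ('X * f)).[t] *
       pospow b (1 - t ^+ 2)).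
    have dt : is_derive t (1 : R) (fun t : R => 1 - t ^+ 2) (- (2 * t)).
      have := is_derive_poly (1 - 'X^2 : {poly R}) t.
      rewrite (_ : horner _ = (fun t : R => 1 - t ^+ 2)); last first.
        by apply/funext => y; rewrite hornerD hornerN hornerC hornerXn.
      rewrite derivB derivC derivXn sub0r hornerN hornerMn hornerXn.
      by rewrite -mulr_natl.
    have dp : is_derive t (1 : R) (fun t : R => (1 - t ^+ 2) `^ (b + 1))
        ((b + 1) * (1 - t ^+ 2) `^ b * - (2 * t)).
      apply: (@is_derive1_comp _ (fun y => y `^ (b + 1)) (fun t => 1 - t ^+ 2)).
      by have := is_derive1_powR (b + 1) t0; rewrite addrK.
    apply: (is_derive_eq (is_deriveM dp (is_derive_poly f t))).
    rewrite !(hornerD, hornerN, hornerZ, hornerM, hornerX, hornerXn, hornerC).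
    rewrite pospowE// /GRing.scale/= powRD ?(gt_eqF t0) ?implybT// powRr1 ?ltW//; ring.
  apply: near_eq_is_derive dG; near=> y; rewrite /F pospowE// subr_gt0.
  have : y \in `]-1, 1[ by near: y; apply: near_in_itvoo; rewrite in_itv/= t1.
  by rewrite in_itv/= => /andP[? ?]; nra.
rewrite /jacobi_functional /Rintegral (@continuous_FTC2 _ _ F).
- by rewrite /F !expr2 mulrNN !mulr1 subrr pospow_le0// !mul0r subee.
- lra.
- by apply: continuous_subspaceT; exact: continuous_fw.
- split.
  + move=> t; rewrite in_itv/= => t1.
    by have [] := dF t t1.
  + by have /left_right_continuousP[] := cF (-1).
  + by have /left_right_continuousP[] := cF 1.
- move=> t; rewrite in_itv/= => t1.
  rewrite derive1E; have [_ ->] := dF t t1.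
  by rewrite weightE.
Unshelve. all: by end_near. Qed.

Lemma jacobi_functional_ibp (f : {poly R}) :
  jacobi_functional ((1 - 'X^2) * f^`()) =
  (2 * b + 1 + 1) * jacobi_functional ('X * f).
Proof.
have := jacobi_ibp0 f; rewrite addrC -scaleNr jacobi_functional_linear.
by move/eqP; rewrite mulNr addrC subr_eq0 => /eqP.
Qed.

Lemma jacobi_functional1 : jacobi_functional 1 =
  Num.sqrt pi * Gamma (b + 1) / Gamma (b + 2^-1 + 1).
Proof.
apply: EFin_inj; rewrite -beta_integralE// -jacobi_functionalE.
by apply: eq_integral => t _; rewrite hornerC mul1r.
Qed.

Lemma jacobi_endpoint_bound d (q : {poly R}) : (size q <= d.+1)%N ->
  ((q.[1] ^+ 2)%:E * beta_integral b <=
   (endpoint_kernel (2 * b + 1) d).[1]%:E *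
   \int[leb]_t ((q.[t]) ^+ 2 * pospow b (1 - t ^+ 2))%:E)%E.
Proof.
move=> qd; rewrite beta_integralE// -jacobi_functional1.
under eq_integral do rewrite -horner_exp.
rewrite jacobi_functionalE -!EFinM lee_fin.
have a0 : 0 < 2 * b + 1 by rewrite ltr_wpDl ?mulr_ge0.
apply: endpoint_kernel_bound => //.
- exact: jacobi_functional_linear.
- exact: jacobi_functional_ibp.
- exact: jacobi_functional_ge0.
Qed.

End jacobi.

(** * Lebesgue measure on row vectors *)

Section lebesgue_rV_integral.
Context {R : realType}.
Local Notation leb := (@lebesgue_measure R).

Lemma integral_rVS n (f : 'rV[R]_n.+1 -> \bar R) :
  measurable_fun setT f -> (forall x, 0 <= f x)%E ->
  (\int[lebesgue_rV n.+1]_x f x =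
   \int[leb]_t \int[lebesgue_rV n]_z f (rV_cons (t, z)))%E.
Proof.
move=> mf f0; rewrite [LHS](@ge0_integral_pushforward _ _ _ _ _ (@rV_cons R n))//=.
- rewrite preimage_setT fubini_tonelli1//=.
  exact: measurableT_comp mf (@measurable_rV_cons R n).
- exact: measurable_rV_cons.
Qed.

Lemma measurable_rVS_section n (f : 'rV[R]_n.+1 -> \bar R) :
  measurable_fun setT f -> (forall x, 0 <= f x)%E ->
  measurable_fun [set: measurableTypeR R]
    (fun t : measurableTypeR R => \int[lebesgue_rV n]_z f (rV_cons (t, z)))%E.
Proof.
move=> mf f0.
apply: (measurable_fun_fubini_tonelli_F (m2 := lebesgue_rV n) (f \o @rV_cons R n)).
  exact: measurableT_comp mf (@measurable_rV_cons R n).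
by move=> u; exact: f0.
Qed.

Lemma rV_cons0 n (u : measurableTypeR R * 'rV[R]_n) : rV_cons u ord0 ord0 = u.1.
Proof. by rewrite -[in RHS](rV_consK u). Qed.

Lemma rV_consS n (u : measurableTypeR R * 'rV[R]_n) i :
  rV_cons u ord0 (lift ord0 i) = u.2 ord0 i.
Proof.
rewrite (_ : lift ord0 i = rshift 1 i); last exact: val_inj.
by rewrite (@row_mxEr _ 1 1 n).
Qed.

Lemma rV_cons_affine n (c : 'rV[R]_n.+1) (s t : R) (z : 'rV[R]_n) :
  c + s *: rV_cons (t, z) =
  rV_cons (c ord0 ord0 + s * t, (rV_uncons c).2 + s *: z).
Proof.
apply/rowP => i; rewrite 2!mxE; have [j ->|->] := unliftP ord0 i.
  rewrite !rV_consS !mxE/=; congr (c _ _ + _); exact: val_inj.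
by rewrite !rV_cons0.
Qed.

Lemma measurable_rV_affine n (c : 'rV[R]_n) (s : R) :
  measurable_fun setT (fun x : 'rV[R]_n => c + s *: x).
Proof.
apply: measurable_fun_rV => i.
rewrite (_ : (fun _ => _) = (fun x : 'rV[R]_n => c ord0 i + s * x ord0 i)).
  by apply: measurable_funD => //; apply: measurable_funM => //; exact: measurable_coord.
by apply/funext => x; rewrite !mxE.
Qed.

Lemma integral_rV_affine n (c : 'rV[R]_n) (s : R) (f : 'rV[R]_n -> \bar R) :
  s != 0 -> measurable_fun setT f -> (forall x, 0 <= f x)%E ->
  (\int[lebesgue_rV n]_x f x =
   (`|s| ^+ n)%:E * \int[lebesgue_rV n]_x f (c + s *: x)%R)%E.
Proof.
move=> s0; elim: n c f => [|n IH] c f mf f0.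
  rewrite expr0 mul1e; apply: eq_integral => x _.
  by congr f; apply/rowP => -[].
have mfa := measurableT_comp mf (measurable_rV_affine c s).
have mfc t : measurable_fun setT (fun z : 'rV[R]_n => f (rV_cons (t, z))).
  apply: (measurableT_comp mf).
  exact: measurableT_comp (@measurable_rV_cons R n) (pair1_measurable _).
rewrite integral_rVS// integral_rVS//.
rewrite (integral_affine (c ord0 ord0) s0); last 2 first.
- exact: measurable_rVS_section.
- by move=> t; exact: integral_ge0.
rewrite exprS EFinM -muleA; congr (_ * _)%E.
rewrite -ge0_integralZl//=; last 2 first.
- by apply: (measurable_rVS_section mfa) => x; exact: f0.
- by move=> t _; exact: integral_ge0.
apply: eq_integral => t _.
rewrite (IH (rV_uncons c).2)//; congr (_ * _)%E.
by apply: eq_integral => z _; rewrite rV_cons_affine.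
Qed.

End lebesgue_rV_integral.

(** * Weighted unit balls *)

Section ball_weight.
Context {R : realType}.
Local Notation leb := (@lebesgue_measure R).
Implicit Types (n : nat) (r : R).

Definition sqnorm n (x : 'rV[R]_n) : R := \sum_i x ord0 i ^+ 2.

Lemma sqnorm_ge0 n (x : 'rV[R]_n) : 0 <= sqnorm x.
Proof. by apply: sumr_ge0 => i _; exact: sqr_ge0. Qed.

Lemma sqnorm_rV_cons n t (z : 'rV[R]_n) :
  sqnorm (rV_cons (t, z)) = t ^+ 2 + sqnorm z.
Proof.
rewrite /sqnorm big_ord_recl rV_cons0; congr (_ + _).
by apply: eq_bigr => i _; rewrite rV_consS.
Qed.

Lemma sqnormZ n a (x : 'rV[R]_n) : sqnorm (a *: x) = a ^+ 2 * sqnorm x.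
Proof. by rewrite /sqnorm mulr_sumr; apply: eq_bigr => i _; rewrite mxE exprMn. Qed.

Lemma measurable_sqnorm n : measurable_fun setT (@sqnorm n).
Proof.
by apply: measurable_sum => i; apply: measurable_funX; exact: measurable_coord.
Qed.

Definition ball_weight n r (x : 'rV[R]_n) : R := pospow r (1 - sqnorm x).

Lemma ball_weight_ge0 n r (x : 'rV[R]_n) : 0 <= ball_weight r x.
Proof. exact: pospow_ge0. Qed.

Lemma measurable_ball_weight n r : measurable_fun setT (@ball_weight n r).
Proof.
apply: measurableT_comp; first exact: measurable_pospow.
by apply: measurable_funB => //; exact: measurable_sqnorm.
Qed.

(** Rescaling the slice by sqrt(1 - t^2) factors the weight, as 1 - t^2 - (1 - t^2)|z|^2 = (1 -
    t^2)(1 - |z|^2), and has Jacobian (1 - t^2)^(n/2). *)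
Lemma integral_ball_slice n r (f : 'rV[R]_n.+1 -> \bar R) :
  measurable_fun setT f -> (forall x, 0 <= f x)%E ->
  (\int[lebesgue_rV n.+1]_y (f y * (ball_weight r y)%:E) =
   \int[leb]_t ((pospow (r + n%:R / 2) (1 - t ^+ 2))%:E *
     \int[lebesgue_rV n]_z (f (rV_cons (t, Num.sqrt (1 - t ^+ 2) *: z)) *
                            (ball_weight r z)%:E)))%E.
Proof.
move=> mf f0.
have mfw : measurable_fun setT (fun y => f y * (ball_weight r y)%:E)%E.
  by apply: emeasurable_funM => //; apply/measurable_EFinP; exact: measurable_ball_weight.
have fw0 y : (0 <= f y * (ball_weight r y)%:E)%E.
  by rewrite mule_ge0// lee_fin ball_weight_ge0.
rewrite integral_rVS//; apply: eq_integral => t _.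
have [t0|t0] := ltP 0 (1 - t ^+ 2); last first.
  rewrite pospow_le0// mul0e; apply: integral0_eq => z _.
  rewrite /ball_weight sqnorm_rV_cons opprD addrA pospow_le0 ?mule0//.
  by rewrite subr_le0 (le_trans t0)// sqnorm_ge0.
have s0 : 0 < Num.sqrt (1 - t ^+ 2) by rewrite sqrtr_gt0.
rewrite (integral_rV_affine 0 (lt0r_neq0 s0)); last 2 first.
- apply: (measurableT_comp mfw).
  exact: measurableT_comp (@measurable_rV_cons R n) (pair1_measurable _).
- by move=> z; exact: fw0.
rewrite (pospowE (r + n%:R / 2) t0).
rewrite powRD; last by rewrite (gt_eqF t0) implybT.
rewrite mulrC EFinM -muleA.
have -> : `|Num.sqrt (1 - t ^+ 2)| ^+ n = (1 - t ^+ 2) `^ (n%:R / 2).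
  by rewrite gtr0_norm// -powR12_sqrt ?(ltW t0)// -(powR_mulrn _ (powR_ge0 _ _)) -powRrM mulrC.
congr (_ * _)%E; rewrite -ge0_integralZl//=.
- apply: eq_integral => z _; rewrite add0r muleCA; congr (_ * _)%E.
  rewrite /ball_weight sqnorm_rV_cons sqnormZ sqr_sqrtr ?(ltW t0)//.
  by rewrite opprD addrA -[X in X - _]mulr1 -mulrBr pospowM.
- apply: emeasurable_funM; last by apply/measurable_EFinP; exact: measurable_ball_weight.
  apply: (measurableT_comp mf); apply: (measurableT_comp (@measurable_rV_cons R n)).
  apply: measurable_fun_pair => //=.
  have := @measurable_rV_affine R n 0 (Num.sqrt (1 - t ^+ 2)).
  by under eq_fun do rewrite add0r.
- by move=> z _; rewrite mule_ge0// lee_fin ball_weight_ge0.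
- by rewrite lee_fin powR_ge0.
Qed.

Definition ball_volume n r : \bar R :=
  \int[lebesgue_rV n]_z (ball_weight r z)%:E.

Lemma ball_volumeS n r :
  ball_volume n.+1 r = (beta_integral (r + n%:R / 2) * ball_volume n r)%E.
Proof.
have := @integral_ball_slice n r (cst 1%E) (measurable_cst _).
move=> /(_ (fun=> lee01)).
under eq_integral do rewrite mul1e.
rewrite -/(ball_volume _ _) => ->.
under eq_integral do under eq_integral do rewrite mul1e.
rewrite -/(ball_volume _ _) ge0_integralZr//=.
- apply/measurable_EFinP; apply: measurableT_comp.
    exact: measurable_pospow.
  by apply: measurable_funB => //; apply: measurable_funX.
- by move=> t _; rewrite lee_fin pospow_ge0.
- by apply: integral_ge0 => z _; rewrite lee_fin ball_weight_ge0.
Qed.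

Lemma cgamma_gt0 n r : 0 <= r -> 0 < cgamma n r.
Proof.
move=> r0; rewrite /cgamma divr_gt0 ?mulr_gt0 ?Gamma_gt0 ?powR_gt0 ?pi_gt0//.
by rewrite addr_ge0.
Qed.

(** Each dimension contributes one beta integral, and the resulting quotients of Gamma values
    telescope to the constant c_r. *)
Lemma ball_volumeE n r : 0 <= r -> ball_volume n r = ((cgamma n r)^-1)%:E.
Proof.
move=> r0; elim: n => [|n IH].
  rewrite /ball_volume/= integral_dirac//=; last first.
    by apply/measurable_EFinP; exact: measurable_ball_weight.
  rewrite diracE in_setT mul1e /ball_weight /sqnorm big_ord0 subr0 pospowE//.
  rewrite powR1 /cgamma mul0r powRr0 mul1r add0r divff ?invr1//.
  by rewrite gt_eqF// Gamma_gt0.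
have rn : 0 <= r + n%:R / 2 by rewrite addr_ge0.
rewrite ball_volumeS IH beta_integralE// -EFinM; congr EFin.
rewrite /cgamma !invf_div.
have -> : r + n%:R / 2 + 1 = n%:R / 2 + r + 1 by ring.
have -> : r + n%:R / 2 + 2^-1 + 1 = n.+1%:R / 2 + r + 1.
  by rewrite -natr1; field.
have -> : pi `^ (n.+1%:R / 2) = pi `^ (n%:R / 2) * Num.sqrt pi :> R.
  rewrite -powR12_sqrt ?pi_ge0// -powRD; last first.
    by rewrite (gt_eqF (pi_gt0 R)) implybT.
  by congr (_ `^ _); rewrite -natr1; field.
have /lt0r_neq0 : 0 < Gamma (n%:R / 2 + r + 1) :> R by rewrite Gamma_gt0// addr_ge0.
have /lt0r_neq0 : 0 < Gamma (n.+1%:R / 2 + r + 1) :> R by rewrite Gamma_gt0// addr_ge0.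
move: (Gamma _) (Gamma _) (Gamma _) (pi `^ _) (Num.sqrt _) => G1 G2 G3 P S h1 h2.
field.
by rewrite h1 h2.
Qed.

End ball_weight.

(** * Reflections *)

Section isometry.
Context {R : realType}.
Implicit Types (n : nat) (r : R).

Definition dotrv n (x y : 'rV[R]_n) : R := \sum_i x ord0 i * y ord0 i.

Lemma dotrvC n (x y : 'rV[R]_n) : dotrv x y = dotrv y x.
Proof. by apply: eq_bigr => i _; rewrite mulrC. Qed.

Lemma dotrvDl n (x y z : 'rV[R]_n) : dotrv (x + y) z = dotrv x z + dotrv y z.
Proof. by rewrite -big_split; apply: eq_bigr => i _; rewrite mxE mulrDl. Qed.

Lemma dotrvZl n a (x z : 'rV[R]_n) : dotrv (a *: x) z = a * dotrv x z.
Proof. by rewrite mulr_sumr; apply: eq_bigr => i _; rewrite mxE mulrA. Qed.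

Lemma sqnormE n (x : 'rV[R]_n) : sqnorm x = dotrv x x.
Proof. by apply: eq_bigr => i _; rewrite expr2. Qed.

Lemma sqnormD n (x y : 'rV[R]_n) :
  sqnorm (x + y) = sqnorm x + 2 * dotrv x y + sqnorm y.
Proof.
rewrite !sqnormE dotrvDl ![dotrv _ (x + y)]dotrvC !dotrvDl (dotrvC y x); ring.
Qed.

Lemma sqnorm_eq0 n (x : 'rV[R]_n) : (sqnorm x == 0) = (x == 0).
Proof.
apply/idP/eqP => [|->]; last first.
  by rewrite /sqnorm big1// => i _; rewrite mxE expr0n.
rewrite psumr_eq0 => [/allP x0|i _]; last exact: sqr_ge0.
apply/rowP => i; have := x0 i (mem_index_enum i).
by rewrite sqrf_eq0 mxE => /eqP.
Qed.

(* For v = 0 this is the identity, since x / 0 = 0. *)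
Definition householder n (v x : 'rV[R]_n) : 'rV[R]_n :=
  x - (2 * dotrv x v / sqnorm v) *: v.

Lemma householderD n (v x y : 'rV[R]_n) :
  householder v (x + y) = householder v x + householder v y.
Proof.
rewrite /householder dotrvDl mulrDr mulrDl scalerDl.
by rewrite opprD addrACA.
Qed.

Lemma dot_householder n (v x : 'rV[R]_n) :
  dotrv (householder v x) v = - dotrv x v.
Proof.
rewrite /householder dotrvDl -scaleNr dotrvZl -sqnormE.
have [/eqP|v0] := eqVneq (sqnorm v) 0.
  rewrite sqnorm_eq0 => /eqP ->.
  rewrite [dotrv x 0]dotrvC (_ : dotrv 0 x = 0) ?mulr0 ?mul0r ?oppr0 ?mul0r ?addr0//.
  by rewrite /dotrv big1// => i _; rewrite mxE mul0r.
by field.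
Qed.

Lemma householderK n (v : 'rV[R]_n) : involutive (householder v).
Proof.
move=> x; rewrite {1}/householder dot_householder /householder.
by rewrite mulrN mulNr scaleNr opprK subrK.
Qed.

Lemma sqnorm_householder n (v x : 'rV[R]_n) :
  sqnorm (householder v x) = sqnorm x.
Proof.
have [/eqP|v0] := eqVneq (sqnorm v) 0.
  by rewrite sqnorm_eq0 => /eqP ->; rewrite /householder scaler0 subr0.
rewrite /householder sqnormD -scaleNr sqnormZ dotrvC dotrvZl (dotrvC v x).
by field.
Qed.

(** Equal norms give 2 <x, x - y> = |x - y|^2, so the reflection subtracts exactly x - y from x. *)
Lemma householder_swap n (x y : 'rV[R]_n) : sqnorm x = sqnorm y ->
  householder (x - y) x = y.
Proof.
move=> xy; rewrite /householder.
have [/eqP|v0] := eqVneq (sqnorm (x - y)) 0.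
  by rewrite sqnorm_eq0 subr_eq0 => /eqP ->; rewrite subrr scaler0 subr0.
have e : 2 * dotrv x (x - y) = sqnorm (x - y).
  rewrite sqnormD dotrvC dotrvDl -scaleN1r dotrvZl sqnormZ -xy.
  by rewrite -sqnormE (dotrvC x) dotrvZl (dotrvC y x); ring.
by rewrite e divff// scale1r opprB addrC subrK.
Qed.

Lemma measurable_householder n (v : 'rV[R]_n) : measurable_fun setT (householder v).
Proof.
apply: measurable_fun_rV => i.
rewrite (_ : (fun _ => _) =
  fun x : 'rV[R]_n => x ord0 i - (2 * dotrv x v / sqnorm v) * v ord0 i); last first.
  by apply/funext => x; rewrite !mxE.
apply: measurable_funB; first exact: measurable_coord.
do 2 apply: measurable_funM => //.
apply: measurable_funM => //.
by apply: measurable_sum => j; apply: measurable_funM => //; exact: measurable_coord.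
Qed.

Lemma measurable_rV_add n d (T : measurableType d) (f g : T -> 'rV[R]_n) :
  measurable_fun setT f -> measurable_fun setT g ->
  measurable_fun setT (fun x => f x + g x).
Proof.
move=> mf mg; apply: measurable_fun_rV => i.
rewrite (_ : (fun _ => _) = (fun x => f x ord0 i + g x ord0 i)).
  by apply: measurable_funD; apply: (measurableT_comp (@measurable_coord R n i)).
by apply/funext => x; rewrite mxE.
Qed.

(* With w = ball_weight 0, translation and reflection invariance and Tonelli's
   theorem show that both sides, multiplied by the integral of w, equal the
   double integral of f(x) w(x + H y). *)
Lemma integral_householder n (v : 'rV[R]_n) (f : 'rV[R]_n -> \bar R) :
  measurable_fun setT f -> (forall x, 0 <= f x)%E ->
  (\int[lebesgue_rV n]_x f (householder v x) = \int[lebesgue_rV n]_x f x)%E.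
Proof.
move=> mf f0; pose H := householder v; pose w := @ball_weight R n 0.
have mH : measurable_fun setT H by exact: measurable_householder.
have mw : measurable_fun setT (fun x => (w x)%:E).
  by apply/measurable_EFinP; exact: measurable_ball_weight.
have w0 x : (0 <= (w x)%:E)%E by rewrite lee_fin ball_weight_ge0.
have wH x : w (H x) = w x by rewrite /w /ball_weight sqnorm_householder.
have H0 : H 0 = 0 by apply: (addrI (H 0)); rewrite -householderD !addr0.
have HN x : H (- x) = - H x.
  by apply: (addrI (H x)); rewrite -householderD !subrr; exact: H0.
have m1 : measurable_fun setT (fun xy : 'rV[R]_n * 'rV[R]_n =>
    f xy.1 * (w (xy.1 + H xy.2)%R)%:E)%E.
  apply: emeasurable_funM; first exact: measurableT_comp mf measurable_fst.
  apply: (measurableT_comp mw); apply: measurable_rV_add; first exact: measurable_fst.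
  exact: measurableT_comp mH measurable_snd.
have m2 : measurable_fun setT (fun xy : 'rV[R]_n * 'rV[R]_n =>
    f (xy.1 + H (- xy.2))%R * (w xy.1)%:E)%E.
  apply: emeasurable_funM; last exact: measurableT_comp mw measurable_fst.
  apply: (measurableT_comp mf); apply: measurable_rV_add; first exact: measurable_fst.
  apply: (measurableT_comp mH).
  have := @measurable_rV_affine R n 0 (-1).
  under eq_fun do rewrite add0r scaleN1r.
  by move=> h; exact: measurableT_comp h measurable_snd.
have V : (\int[lebesgue_rV n]_x (w x)%:E)%E = ((cgamma n 0)^-1)%:E.
  exact: ball_volumeE.
have V0 : 0 < (cgamma n 0)^-1 :> R by rewrite invr_gt0 cgamma_gt0.
have m1s x : measurable_fun setT (fun y => (w (x + H y)%R)%:E).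
  apply: (measurableT_comp mw); apply: measurable_rV_add => //.
suff : (((cgamma n 0)^-1)%:E * \int[lebesgue_rV n]_x f x =
        ((cgamma n 0)^-1)%:E * \int[lebesgue_rV n]_x f (H x))%E.
  move=> /(congr1 (fun e => (cgamma n 0)%:E * e)%E).
  rewrite !muleA -EFinM divff ?mul1e//.
  by rewrite gt_eqF// cgamma_gt0.
transitivity (\int[lebesgue_rV n]_x \int[lebesgue_rV n]_y
    (f x * (w (x + H y)%R)%:E))%E.
  rewrite -ge0_integralZl//; last by rewrite lee_fin ltW.
  apply: eq_integral => x _.
  rewrite ge0_integralZl// muleC; congr (_ * _)%E; rewrite -V.
  rewrite (integral_rV_affine (H x) (oner_neq0 R))// normr1 expr1n mul1e.
  apply: eq_integral => y _.
  by rewrite scale1r -wH /H householderD householderK.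
rewrite (fubini_tonelli (fun xy => f xy.1 * (w (xy.1 + H xy.2)%R)%:E)%E)//; last first.
  by move=> xy; rewrite mule_ge0.
transitivity (\int[lebesgue_rV n]_y \int[lebesgue_rV n]_x
    (f (x + H (- y))%R * (w x)%:E))%E.
  apply: eq_integral => y _ /=.
  rewrite (integral_rV_affine (H (- y)) (oner_neq0 R)).
  - rewrite normr1 expr1n mul1e; apply: eq_integral => x _.
    by rewrite scale1r HN /= [(- H y + x + _)%R]addrAC addNr add0r addrC.
  - exact: (measurableT_comp m1 (pair2_measurable y)).
  - by move=> x; rewrite mule_ge0.
rewrite -(fubini_tonelli (fun xy : 'rV[R]_n * 'rV[R]_n => f (xy.1 + H (- xy.2))%R * (w xy.1)%:E)%E)//; last first.
  by move=> xy; rewrite mule_ge0.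
have mfH : measurable_fun setT (f \o H) by exact: measurableT_comp mf mH.
transitivity (\int[lebesgue_rV n]_x
    ((\int[lebesgue_rV n]_y f (H y)) * (w x)%:E))%E; last first.
  rewrite ge0_integralZl//; last by apply: integral_ge0.
  by rewrite V muleC.
apply: eq_integral => x _ /=; rewrite ge0_integralZr//.
- congr (_ * _)%E.
  have N1 : -1 != 0 :> R by rewrite oppr_eq0 oner_neq0.
  rewrite (integral_rV_affine (H x) N1 mfH)//; last by move=> y /=.
  rewrite normrN1 expr1n mul1e; apply: eq_integral => y _ /=.
  by rewrite scaleN1r /H householderD -/H [H (H x)]householderK.
- apply: (measurableT_comp mf); apply: measurable_rV_add => //.
  have := @measurable_rV_affine R n 0 (-1).
  under eq_fun do rewrite add0r scaleN1r.
  by move=> h; exact: measurableT_comp mH h.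
Qed.

End isometry.

(** * Polynomial functions *)

Section polynomial_functions.
Context {R : realType}.

(** Stated for functions, so that composing with affine maps is plain composition and no
    substitution of formal polynomials is needed. *)
Definition polyfun n (d : nat) (f : 'rV[R]_n -> R) :=
  exists2 P : mpoly n R, poly_deg_le d P & forall x, f x = peval P x.

Lemma polyfun_cst n d (c : R) : @polyfun n d (cst c).
Proof.
exists (mpolyC n c) => [|x]; last by rewrite /peval mevalC.
by rewrite /poly_deg_le/= msizeC; case: (c != 0).
Qed.

Lemma polyfun_coord n (i : 'I_n) : polyfun 1 (fun x : 'rV[R]_n => x ord0 i).
Proof.
exists (mpolyX R (mnm1 i)) => [|x]; last by rewrite /peval mevalXU.
by rewrite /poly_deg_le/= msizeX mdeg1.
Qed.

Lemma polyfunD n d (f g : 'rV[R]_n -> R) :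
  polyfun d f -> polyfun d g -> polyfun d (fun x => f x + g x).
Proof.
move=> [P dP fP] [Q dQ gQ]; exists (P + Q) => [|x].
  by rewrite /poly_deg_le/= (leq_trans (msizeD_le _ _))// geq_max dP.
by rewrite /peval mevalD fP gQ.
Qed.

Lemma polyfunM n d e (f g : 'rV[R]_n -> R) :
  polyfun d f -> polyfun e g -> polyfun (d + e) (fun x => f x * g x).
Proof.
move=> [P dP fP] [Q dQ gQ]; exists (P * Q) => [|x]; last first.
  by rewrite /peval mevalM fP gQ.
rewrite /poly_deg_le/=.
have [->|P0] := eqVneq P 0; first by rewrite mul0r msize0.
have [->|Q0] := eqVneq Q 0; first by rewrite mulr0 msize0.
rewrite msizeM//; move: dP dQ; rewrite /poly_deg_le/=.
by move: (mmeasure _ _) (mmeasure _ _) => a b; lia.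
Qed.

Lemma polyfun_sum n d (I : Type) (s : seq I) (f : I -> 'rV[R]_n -> R) :
  (forall i, polyfun d (f i)) -> polyfun d (fun x => \sum_(i <- s) f i x).
Proof.
move=> df; elim: s => [|i s IH].
  by under eq_fun do rewrite big_nil; exact: polyfun_cst.
by under eq_fun do rewrite big_cons; exact: polyfunD.
Qed.

Lemma polyfunX n d k (f : 'rV[R]_n -> R) :
  polyfun d f -> polyfun (k * d) (fun x => f x ^+ k).
Proof.
move=> df; elim: k => [|k IH]; first exact: polyfun_cst.
by under eq_fun do rewrite exprS; rewrite mulSn; exact: polyfunM.
Qed.

Lemma polyfun_prod n (I : Type) (s : seq I) (d : I -> nat)
    (f : I -> 'rV[R]_n -> R) : (forall i, polyfun (d i) (f i)) ->
  polyfun (\sum_(i <- s) d i) (fun x => \prod_(i <- s) f i x).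
Proof.
move=> df; elim: s => [|i s IH].
  rewrite big_nil (_ : (fun _ => _) = cst 1); first exact: polyfun_cst.
  by apply/funext => x; rewrite big_nil.
rewrite big_cons (_ : (fun _ => _) =
  fun x => f i x * \prod_(j <- s) f j x); first exact: polyfunM.
by apply/funext => x; rewrite big_cons.
Qed.

Lemma polyfun_le n d e (f : 'rV[R]_n -> R) : (d <= e)%N ->
  polyfun d f -> polyfun e f.
Proof. by move=> de [P dP fP]; exists P => //; exact: leq_trans dP _. Qed.

Lemma pevalE n (P : mpoly n R) x : peval P x =
  \sum_(m <- msupp P) mcoeff m P * \prod_i x ord0 i ^+ m i.
Proof. exact: mevalE. Qed.

Lemma polyfun_comp m n d (A : 'rV[R]_m -> 'rV[R]_n) (f : 'rV[R]_n -> R) :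
  (forall i, polyfun 1 (fun y => A y ord0 i)) -> polyfun d f ->
  polyfun d (f \o A).
Proof.
move=> dA [P dP fP]; rewrite /comp.
under eq_fun do rewrite fP pevalE.
(* The guard gives each surviving term its degree bound, while [polyfun_sum] asks for a bound on
   every term; the others become zero. *)
rewrite (_ : (fun _ => _) = fun x => \sum_(k <- msupp P | k \in msupp P)
    (mcoeff k P * \prod_i A x ord0 i ^+ k i)); last first.
  by apply/funext => x; rewrite -big_seq.
under eq_fun do rewrite big_mkcond.
apply: polyfun_sum => k; have [km|_] := boolP (k \in msupp P); last first.
  exact: polyfun_cst.
apply: (@polyfun_le _ (0 + mdeg k)%N).
  by rewrite -ltnS (leq_trans (msize_mdeg_lt km)).
apply: polyfunM; first exact: polyfun_cst.
rewrite mdegE; apply: polyfun_prod => i.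
by rewrite -[X in polyfun X](muln1); exact: polyfunX.
Qed.

Lemma measurable_polyfun n d (f : 'rV[R]_n -> R) :
  polyfun d f -> measurable_fun setT f.
Proof.
move=> [P _ fP]; rewrite (_ : f = peval P); last exact/funext.
rewrite (_ : peval P = fun x => \sum_(m <- msupp P)
    mcoeff m P * \prod_i x ord0 i ^+ m i); last by apply/funext => x; rewrite pevalE.
apply: measurable_sum => m; apply: measurable_funM => //.
by apply: measurable_prod => i _; apply: measurable_funX; exact: measurable_coord.
Qed.

End polynomial_functions.

(** * Averages over slices of the ball *)

Section ball_mean.
Context {R : realType}.
Local Notation leb := (@lebesgue_measure R).
Variables (n : nat) (r : R).
Hypothesis r0 : 0 <= r.
Local Notation w := (@ball_weight R n r).
Local Notation lam := (@lebesgue_rV R n).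

(** A bound on the open unit ball suffices for integrability, since the weight vanishes elsewhere,
    and every polynomial has one. *)
Definition ball_bounded (g : 'rV[R]_n -> R) :=
  measurable_fun setT g /\
  exists M : R, forall z, sqnorm z < 1 -> `|g z| <= M.

Lemma ball_boundedD f g : ball_bounded f -> ball_bounded g ->
  ball_bounded (fun z => f z + g z).
Proof.
move=> [mf [M fM]] [mg [N gN]]; split; first exact: measurable_funD.
exists (M + N) => z z1; rewrite (le_trans (ler_normD _ _))//.
by rewrite lerD ?fM ?gN.
Qed.

Lemma ball_boundedM f g : ball_bounded f -> ball_bounded g ->
  ball_bounded (fun z => f z * g z).
Proof.
move=> [mf [M fM]] [mg [N gN]]; split; first exact: measurable_funM.
by exists (M * N) => z z1; rewrite normrM ler_pM ?fM ?gN.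
Qed.

Lemma ball_bounded_cst c : ball_bounded (cst c).
Proof. by split => //; exists `|c|. Qed.

Lemma ball_bounded_sum (I : Type) (s : seq I) f :
  (forall i, ball_bounded (f i)) -> ball_bounded (fun z => \sum_(i <- s) f i z).
Proof.
move=> bf; elim: s => [|i s IH].
  by under eq_fun do rewrite big_nil; exact: ball_bounded_cst.
by under eq_fun do rewrite big_cons; exact: ball_boundedD.
Qed.

Lemma ball_bounded_prod (I : Type) (s : seq I) f :
  (forall i, ball_bounded (f i)) -> ball_bounded (fun z => \prod_(i <- s) f i z).
Proof.
move=> bf; elim: s => [|i s IH].
  by under eq_fun do rewrite big_nil; exact: ball_bounded_cst.
by under eq_fun do rewrite big_cons; exact: ball_boundedM.
Qed.

Lemma ball_bounded_coordX i k : ball_bounded (fun z => z ord0 i ^+ k).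
Proof.
split; first by apply: measurable_funX; exact: measurable_coord.
exists 1 => z z1; rewrite normrX exprn_ile1//.
rewrite -(ler_pXn2r (n := 2)) ?nnegrE// expr1n real_normK ?num_real//.
apply: le_trans (ltW z1); rewrite /sqnorm (bigD1 i)//= lerDl.
by apply: sumr_ge0 => j _; exact: sqr_ge0.
Qed.

Lemma ball_integrable g : ball_bounded g ->
  lam.-integrable setT (fun z => (g z * w z)%:E).
Proof.
move=> [mg [M gM]].
have mw : measurable_fun setT w by exact: measurable_ball_weight.
apply: (@le_integrable _ _ _ _ _ _ _ (fun z => (`|M| * w z)%:E)) => //.
- by apply/measurable_EFinP; exact: measurable_funM.
- move=> z _; rewrite !abse_EFin lee_fin !normrM normr_id.
  have [z1|z1] := ltP (sqnorm z) 1; last first.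
    by rewrite /ball_weight pospow_le0 ?subr_le0// normr0 !mulr0.
  by rewrite ler_wpM2r// (le_trans (gM _ z1))// ler_norm.
apply/integrableP; split.
  by apply/measurable_EFinP; exact: measurable_funM.
under eq_integral do
  rewrite abse_EFin ger0_norm ?mulr_ge0 ?ball_weight_ge0// EFinM.
rewrite ge0_integralZl//=.
- by rewrite -/(ball_volume _ _) ball_volumeE// -EFinM ltry.
- by apply/measurable_EFinP.
- by move=> z _; rewrite lee_fin ball_weight_ge0.
Qed.

Definition ball_mean (g : 'rV[R]_n -> R) : R :=
  cgamma n r * \int[lam]_z (g z * w z).

Lemma ball_mean_linear c f g : ball_bounded f -> ball_bounded g ->
  ball_mean (fun z => c * f z + g z) = c * ball_mean f + ball_mean g.
Proof.
move=> bf bg; rewrite /ball_mean mulrCA -mulrDr; congr (_ * _).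
rewrite -RintegralZl//; last exact: ball_integrable.
rewrite -RintegralD//.
- by apply: eq_Rintegral => z _; ring.
- have := ball_integrable (ball_boundedM (ball_bounded_cst c) bf).
  by under eq_fun do rewrite -mulrA.
- exact: ball_integrable.
Qed.

Lemma ball_mean_cst c : ball_mean (cst c) = c.
Proof.
have c0 : cgamma n r != 0 by rewrite gt_eqF// cgamma_gt0.
have e : \int[lam]_z w z = (cgamma n r)^-1.
  by rewrite /Rintegral -/(ball_volume n r) ball_volumeE.
rewrite /ball_mean RintegralZl//.
  by rewrite e; field.
have := ball_integrable (ball_bounded_cst 1).
by under eq_fun do rewrite mul1r.
Qed.

Lemma ball_mean0 : ball_mean (fun=> 0) = 0.
Proof. exact: ball_mean_cst. Qed.

Lemma ball_mean_sum (I : Type) (s : seq I) (c : I -> R) f :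
  (forall i, ball_bounded (f i)) ->
  ball_mean (fun z => \sum_(i <- s) c i * f i z) =
  \sum_(i <- s) c i * ball_mean (f i).
Proof.
move=> bf; elim: s => [|i s IH].
  rewrite big_nil -[RHS]ball_mean0; congr ball_mean.
  by apply/funext => z; rewrite big_nil.
rewrite big_cons -IH -ball_mean_linear//; last first.
  by apply: ball_bounded_sum => j; exact: ball_boundedM (ball_bounded_cst _) _.
by congr ball_mean; apply/funext => z; rewrite big_cons.
Qed.

Lemma ball_mean_odd (g : 'rV[R]_n -> R) : measurable_fun setT g ->
  (forall z, g (- z) = - g z) -> ball_mean g = 0.
Proof.
move=> mg gN; rewrite /ball_mean.
suff -> : \int[lam]_z (g z * w z) = 0 by rewrite mulr0.
pose f (z : 'rV[R]_n) := (g z * w z)%:E.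
have mf : measurable_fun setT f.
  by apply/measurable_EFinP; apply: measurable_funM => //; exact: measurable_ball_weight.
have fN z : f (- z) = (- f z)%E.
  rewrite /f gN mulNr EFinN /ball_weight.
  by rewrite -[in sqnorm _]scaleN1r sqnormZ sqrrN expr1n mul1r.
rewrite /Rintegral -/f integralE.
have e : (\int[lam]_z f^\+ z = \int[lam]_z f^\- z)%E.
  have N1 : -1 != 0 :> R by rewrite oppr_eq0 oner_neq0.
  rewrite (integral_rV_affine 0 N1)//; last exact: measurable_funepos.
  rewrite normrN1 expr1n mul1e; apply: eq_integral => z _.
  by rewrite add0r scaleN1r funeposE funenegE fN.
(* If the common value is infinite, the difference is infinite too, and [fine] sends it to 0. *)
rewrite e; case: (\int[lam]_z f^\- z)%E => [x| |] //=.
by rewrite subrr.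
Qed.

(** The variance of g under the normalized weight is nonnegative. *)
Lemma ball_mean_jensen g : ball_bounded g ->
  (((ball_mean g) ^+ 2)%:E * ((cgamma n r)^-1)%:E <=
   \int[lam]_z (g z ^+ 2 * w z)%:E)%E.
Proof.
move=> bg; have bg2 := ball_boundedM bg bg.
have c0 : 0 < cgamma n r by rewrite cgamma_gt0.
set m := ball_mean g.
have h : 0 <= ball_mean (fun z => (g z - m) ^+ 2).
  rewrite mulr_ge0 ?(ltW c0)//; apply: Rintegral_ge0 => z _.
  by rewrite mulr_ge0 ?sqr_ge0 ?ball_weight_ge0.
have e : ball_mean (fun z => (g z - m) ^+ 2) = ball_mean (fun z => g z * g z) - m ^+ 2.
  transitivity (ball_mean (fun z => (- 2 * m) * g z + (1 * (g z * g z) + m ^+ 2))).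
    by congr ball_mean; apply/funext => z; ring.
  rewrite !ball_mean_linear//.
  - by rewrite (ball_mean_cst (m ^+ 2)) -/m; ring.
  - exact: ball_bounded_cst.
  - apply: ball_boundedD; last exact: ball_bounded_cst.
    exact: ball_boundedM (ball_bounded_cst _) _.
rewrite e subr_ge0 in h.
have -> : (\int[lam]_z (g z ^+ 2 * w z)%:E)%E = (\int[lam]_z (g z * g z * w z))%:E.
  rewrite /Rintegral fineK//; exact: integrable_fin_num (ball_integrable bg2).
by rewrite -EFinM lee_fin ler_pdivrMr// mulrC.
Qed.

End ball_mean.

(** * The endpoint inequality on the weighted unit ball *)

Section ball_endpoint.
Context {R : realType}.
Local Notation leb := (@lebesgue_measure R).
Implicit Types (n d : nat) (r : R).

(** Only s^2 = 1 - t^2 is imposed on s, so the same Q serves for s = sqrt(1 - t^2) inside the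
    interval and for s = 0 at t = 1. *)
Lemma slice_mean_polynomial n d r (f : 'rV[R]_n.+1 -> R) :
  0 <= r -> polyfun d f ->
  exists2 Q : {poly R}, (size Q <= d.+1)%N &
    forall t s, s ^+ 2 = 1 - t ^+ 2 ->
      Q.[t] = ball_mean r (fun z : 'rV[R]_n => f (rV_cons (t, s *: z))).
Proof.
move=> r0 [P dP fP].
pose mon (m : multinom n.+1) (z : 'rV[R]_n) : R :=
  \prod_i z ord0 i ^+ m (lift ord0 i).
pose deg (m : multinom n.+1) := (\sum_i m (lift ord0 i))%N.
have bmon m : ball_bounded (mon m).
  by apply: ball_bounded_prod => i; exact: ball_bounded_coordX.
have mean_mon_odd m : odd (deg m) -> ball_mean r (mon m) = 0.
  move=> om; apply: ball_mean_odd => [|z]; first by case: (bmon m).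
  rewrite /mon (eq_bigr (fun i => (-1) ^+ m (lift ord0 i) *
      z ord0 i ^+ m (lift ord0 i))); last first.
    by move=> i _; rewrite mxE -exprMn mulN1r.
  by rewrite big_split/= prodrXr -/(deg m) -signr_odd om expr1 mulN1r.
(* Halving rounds down when [deg m] is odd, but the mean of such a monomial is zero. For even
   [deg m] the power of 1 - t^2 is s^(deg m). *)
exists (\sum_(m <- msupp P) (mcoeff m P * ball_mean r (mon m)) *:
   ('X^(m ord0) * (1 - 'X^2) ^+ (deg m)./2)).
  rewrite big_seq; elim/big_rec: _ => [|m Q mP sQ]; first by rewrite size_poly0.
  rewrite (leq_trans (size_polyD _ _))// geq_max sQ andbT.
  rewrite (leq_trans (size_scale_leq _ _))// (leq_trans (size_polyMleq _ _))//.
  rewrite size_polyXn addSn/=.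
  have s2 : (size (1 - 'X^2 : {poly R})%R <= 3)%N.
    by rewrite (leq_trans (size_polyD _ _))// size_polyN size_polyXn size_poly1.
  have := leq_trans (msize_mdeg_lt mP) dP.
  rewrite mdegE big_ord_recl -/(deg m) ltnS => md.
  have := size_poly_exp_leq (1 - 'X^2 : {poly R}) (deg m)./2.
  have := odd_double_half (deg m).
  move: (size _) s2 (size _) => a a3 b h1 h2.
  have : (a.-1 * (deg m)./2 <= 2 * (deg m)./2)%N by rewrite leq_mul2r; lia.
  by lia.
move=> t s st; rewrite horner_sum.
transitivity (ball_mean r (fun z : 'rV[R]_n => \sum_(m <- msupp P)
    (mcoeff m P * t ^+ m ord0 * s ^+ deg m) * mon m z)); last first.
  congr ball_mean; apply/funext => z; rewrite fP pevalE; apply: eq_bigr => m _.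
  rewrite big_ord_recl rV_cons0/= -!mulrA; congr (_ * (_ * _)).
  rewrite /deg -prodrXr -big_split/=; apply: eq_bigr => i _.
  by rewrite rV_consS mxE exprMn.
rewrite ball_mean_sum//; apply: eq_bigr => m _.
rewrite hornerZ hornerM hornerXn horner_exp hornerD hornerN hornerXn hornerC.
have [om|em] := boolP (odd (deg m)); first by rewrite mean_mon_odd// !(mulr0, mul0r).
rewrite -st -exprM mul2n.
by have := odd_double_half (deg m); rewrite (negPf em) add0n => ->; ring.
Qed.

Lemma polyfun_ball_bounded n d (f : 'rV[R]_n -> R) :
  polyfun d f -> ball_bounded f.
Proof.
move=> [P _ fP]; rewrite (_ : f = fun x => \sum_(m <- msupp P)
    mcoeff m P * \prod_i x ord0 i ^+ m i); last first.
  by apply/funext => x; rewrite fP pevalE.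
apply: ball_bounded_sum => m; apply: ball_boundedM.
  exact: ball_bounded_cst.
by apply: ball_bounded_prod => i; exact: ball_bounded_coordX.
Qed.

Lemma polyfun_rV_cons n (t s : R) (i : 'I_n.+1) :
  polyfun 1 (fun z : 'rV[R]_n => rV_cons (t, s *: z) ord0 i).
Proof.
have [j ->|->] := unliftP ord0 i; last first.
  by under eq_fun do rewrite rV_cons0; exact: polyfun_cst.
under eq_fun do rewrite rV_consS mxE.
by apply: (@polyfunM _ _ 0 1); [exact: polyfun_cst|exact: polyfun_coord].
Qed.

Lemma measurable_rV_scale n (disp : measure_display) (T : measurableType disp)
     (a : T -> R) (g : T -> 'rV[R]_n) :
  measurable_fun setT a -> measurable_fun setT g ->
  measurable_fun setT (fun x => a x *: g x).
Proof.
move=> ma mg; apply: measurable_fun_rV => i.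
rewrite (_ : (fun _ => _) = (fun x => a x * g x ord0 i)).
  by apply: measurable_funM => //; exact: (measurableT_comp (@measurable_coord R n i)).
by apply/funext => x; rewrite mxE.
Qed.

Lemma ball_endpoint_bound n d r (f : 'rV[R]_n.+1 -> R) :
  0 <= r -> polyfun d f ->
  ((f (rV_cons (1, 0)) ^+ 2)%:E <=
   (cgamma n.+1 r * (endpoint_kernel (2 * r + n.+1%:R) d).[1])%:E *
   \int[lebesgue_rV n.+1]_y (f y ^+ 2 * ball_weight r y)%:E)%E.
Proof.
move=> r0 pf; have [Q sQ QE] := slice_mean_polynomial r0 pf.
have mf := measurable_polyfun pf.
set b := r + n%:R / 2; have b0 : 0 <= b by rewrite addr_ge0.
have cn : 0 < cgamma n r by rewrite cgamma_gt0.
have cn1 : 0 < cgamma n.+1 r by rewrite cgamma_gt0.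
have -> : f (rV_cons (1, 0)) = Q.[1].
  (* At t = 1 the slice has radius 0, so the mean is that of a constant. *)
  rewrite (QE 1 0) ?expr0n ?expr1n ?subrr//.
  under eq_fun do rewrite scale0r.
  by rewrite (ball_mean_cst n r0).
(* The ball has dimension n + 1 and its slices dimension n; this is the relation a = 2b + 1 between
   the Gegenbauer parameter and the exponent of the weight. *)
have ab : 2 * r + n.+1%:R = 2 * b + 1 by rewrite /b -natr1; field.
set K := (endpoint_kernel _ d).[1].
have K0 : 0 < K by apply: endpoint_kernel_at1_gt0; rewrite ab ltr_wpDl ?mulr_ge0.
have mp : measurable_fun setT (fun t : R => pospow b (1 - t ^+ 2)).
  apply: measurableT_comp; first exact: measurable_pospow.
  by apply: measurable_funB => //; apply: measurable_funX.
have mQ : measurable_fun setT (horner Q).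
  by apply: continuous_measurable_fun; exact: continuous_horner.
have msqrt : measurable_fun setT (fun t : R => Num.sqrt (1 - t ^+ 2)).
  apply: continuous_measurable_fun => t.
  apply: (@continuous_comp _ _ _ (fun t : R => 1 - t ^+ 2)).
    by apply: cvgB; [exact: cvg_cst|exact: exprn_continuous].
  exact: sqrt_continuous.
have lower : (\int[leb]_t ((pospow b (1 - t ^+ 2))%:E *
      ((Q.[t] ^+ 2)%:E * ((cgamma n r)^-1)%:E)) <=
    \int[lebesgue_rV n.+1]_y (f y ^+ 2 * ball_weight r y)%:E)%E.
  under [leRHS]eq_integral do rewrite EFinM.
  rewrite integral_ball_slice.
  - apply: ge0_le_integral => //.
    + by move=> t _; rewrite !mule_ge0 ?lee_fin ?pospow_ge0 ?sqr_ge0 ?invr_ge0 ?ltW.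
    + apply/measurable_EFinP; apply: measurable_funM => //.
      by apply: measurable_funM => //; apply: measurable_funX.
    + apply: emeasurable_funM; first exact/measurable_EFinP.
      apply: (@measurable_fun_fubini_tonelli_F _ _ _ _ _ (lebesgue_rV n)
        (fun u : measurableTypeR R * 'rV[R]_n =>
         (f (rV_cons (u.1, Num.sqrt (1 - u.1 ^+ 2) *: u.2)) ^+ 2)%:E *
         (ball_weight r u.2)%:E))%E; last first.
        by move=> u; rewrite mule_ge0 ?lee_fin ?sqr_ge0 ?ball_weight_ge0.
      apply: emeasurable_funM; last first.
        apply/measurable_EFinP; apply: measurableT_comp.
          exact: measurable_ball_weight.
        exact: measurable_snd.
      apply/measurable_EFinP; apply: measurable_funX.
      apply: (measurableT_comp mf).
      apply: (measurableT_comp (@measurable_rV_cons R n)).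
      apply: measurable_fun_pair; first exact: measurable_fst.
      apply: measurable_rV_scale; last exact: measurable_snd.
      exact: (measurableT_comp msqrt measurable_fst).
    + move=> t _; rewrite -/b.
      have [t0|t0] := ltP 0 (1 - t ^+ 2); last by rewrite pospow_le0// !mul0e.
      rewrite lee_wpmul2l ?lee_fin ?pospow_ge0//.
      rewrite (QE _ (Num.sqrt (1 - t ^+ 2))) ?sqr_sqrtr ?(ltW t0)//.
      under [leRHS]eq_integral do rewrite -EFinM.
      apply: ball_mean_jensen => //.
      apply: polyfun_ball_bounded (polyfun_comp _ pf) => i.
      exact: polyfun_rV_cons.
  - by apply/measurable_EFinP; exact: measurable_funX.
  - by move=> y; rewrite lee_fin sqr_ge0.
have := jacobi_endpoint_bound b0 sQ.
rewrite -ab -/K beta_integralE// => jb.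
(* The beta integral is the quotient of the weighted volumes in dimensions n + 1 and n, so the Gamma
   values leave the constant. *)
have cB : Num.sqrt pi * Gamma (b + 1) / Gamma (b + 2^-1 + 1) =
    cgamma n r / cgamma n.+1 r :> R.
  apply: EFin_inj; rewrite -beta_integralE//.
  have := ball_volumeS n r; rewrite !ball_volumeE// -/b beta_integralE//.
  move: (Num.sqrt pi * _ / _) => B; rewrite -EFinM => -[->]; congr EFin.
  by rewrite mulrCA divff ?mulr1// gt_eqF.
rewrite {}cB in jb.
apply: (le_trans _ (lee_wpmul2l _ lower)); last by rewrite lee_fin mulr_ge0 ?ltW.
have -> : (\int[leb]_t ((pospow b (1 - t ^+ 2))%:E *
      ((Q.[t] ^+ 2)%:E * ((cgamma n r)^-1)%:E)) = ((cgamma n r)^-1)%:E *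
    \int[leb]_t (Q.[t] ^+ 2 * pospow b (1 - t ^+ 2))%:E)%E.
  rewrite -ge0_integralZl//.
  - by apply: eq_integral => t _; rewrite -!EFinM; congr EFin; ring.
  - apply/measurable_EFinP; apply: measurable_funM => //.
    exact: measurable_funX.
  - by move=> t _; rewrite lee_fin mulr_ge0 ?sqr_ge0 ?pospow_ge0.
  - by rewrite lee_fin invr_ge0 ltW.
rewrite muleA -EFinM.
have -> : cgamma n.+1 r * K / cgamma n r = cgamma n.+1 r / cgamma n r * K by ring.
rewrite [(_ * K)%:E]EFinM -muleA.
apply: (le_trans _ (lee_wpmul2l _ jb)); last by rewrite lee_fin divr_ge0 ?ltW.
rewrite -!EFinM lee_fin le_eqVlt; apply/orP; left; apply/eqP.
by field; rewrite !gt_eqF.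
Qed.

End ball_endpoint.

(** * Balls and densities *)

Section eball_bound.
Context {R : realType}.
Implicit Types (n d : nat) (r : R).

Lemma enormE n (x : 'rV[R]_n) : enorm x = Num.sqrt (sqnorm x).
Proof. by []. Qed.

Lemma enorm_sqr n (x : 'rV[R]_n) : enorm x ^+ 2 = sqnorm x.
Proof. by rewrite enormE sqr_sqrtr// sqnorm_ge0. Qed.

Lemma polyfun_householder n (v c : 'rV[R]_n) (s : R) (i : 'I_n) :
  polyfun 1 (fun y => (c + s *: householder v y) ord0 i).
Proof.
have pdot : polyfun 1 (fun y : 'rV[R]_n => dotrv y v).
  apply: polyfun_sum => j; apply: (@polyfunM _ _ 1 0); last exact: polyfun_cst.
  exact: polyfun_coord.
rewrite (_ : (fun _ => _) = fun y : 'rV[R]_n => c ord0 i +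
    s * (y ord0 i + (dotrv y v * (- (2 / sqnorm v * v ord0 i))))); last first.
  by apply/funext => y; rewrite !mxE; ring.
apply: polyfunD; first exact: polyfun_cst.
apply: (@polyfunM _ _ 0 1); first exact: polyfun_cst.
apply: polyfunD; first exact: polyfun_coord.
by apply: (@polyfunM _ _ 1 0) => //; exact: polyfun_cst.
Qed.

Lemma measurable_ball_weight_affine n r (c : 'rV[R]_n) (s : R) :
  measurable_fun setT (fun y : 'rV[R]_n => ball_weight r (s *: (y - c))).
Proof.
apply: measurableT_comp; first exact: measurable_ball_weight.
have := @measurable_rV_affine R n (- (s *: c)) s.
by under eq_fun do rewrite addrC -scalerBr.
Qed.

(** With H the reflection exchanging e and (x - c)/s, the map y -> c + s H(y) carries the unit ball
    to the ball of radius s about c, and e to x. It preserves degrees, and its Jacobian accounts for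
    the power of s. *)
Lemma eball_endpoint_bound n d r (f : 'rV[R]_n.+1 -> R) (c x : 'rV[R]_n.+1) (s : R) :
  0 <= r -> polyfun d f -> 0 < s -> enorm (x - c) = s ->
  ((f x ^+ 2)%:E <=
   (cgamma n.+1 r * (endpoint_kernel (2 * r + n.+1%:R) d).[1] / s ^+ n.+1)%:E *
   \int[lebesgue_rV n.+1]_y
     (f y ^+ 2 * ball_weight r (s^-1 *: (y - c)))%:E)%E.
Proof.
move=> r0 pf s0 xcs.
pose e0 : 'rV[R]_n.+1 := rV_cons (1, 0).
pose u := s^-1 *: (x - c); pose H := householder (e0 - u).
have He0 : H e0 = u.
  apply: householder_swap; rewrite /u sqnormZ -(enorm_sqr (x - c)) xcs -exprMn.
  rewrite mulVf ?gt_eqF// expr1n sqnorm_rV_cons expr1n /sqnorm big1 ?addr0//.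
  by move=> i _; rewrite mxE expr0n.
have pF := polyfun_comp (polyfun_householder (e0 - u) c s) pf.
have := ball_endpoint_bound r0 pF.
have -> : (f \o (fun y => c + s *: householder (e0 - u) y)) (rV_cons (1, 0)) = f x.
  by rewrite /= -/e0 -/H He0 scalerA divff ?gt_eqF// scale1r addrC subrK.
move=> /le_trans; apply.
rewrite [in leRHS]EFinM -muleA lee_wpmul2l//.
  rewrite lee_fin mulr_ge0 ?ltW ?cgamma_gt0//.
  by apply: endpoint_kernel_at1_gt0; rewrite ltr_wpDl// mulr_ge0.
have mf := measurable_polyfun pf.
pose h y := (f y ^+ 2 * ball_weight r (s^-1 *: (y - c)))%:E.
have mh : measurable_fun setT h.
  apply/measurable_EFinP; apply: measurable_funM; first exact: measurable_funX.
  exact: measurable_ball_weight_affine.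
have h0 y : (0 <= h y)%E by rewrite lee_fin mulr_ge0 ?sqr_ge0 ?ball_weight_ge0.
rewrite -/(h _) [in leRHS](integral_rV_affine c (lt0r_neq0 s0) mh h0).
rewrite muleA -EFinM gtr0_norm// mulVf ?mul1e; last by rewrite gt_eqF// exprn_gt0.
rewrite -(integral_householder (e0 - u)).
- rewrite le_eqVlt; apply/orP; left; apply/eqP; apply: eq_integral => y _ /=.
  have e z : s^-1 *: (c + s *: z - c) = z.
    by rewrite addrAC subrr add0r scalerA mulVf ?gt_eqF// scale1r.
  by rewrite /h e /ball_weight sqnorm_householder householderK.
- apply/measurable_EFinP; apply: measurable_funM; last exact: measurable_ball_weight.
  by apply: measurable_funX; exact: measurable_polyfun pF.
- by move=> y; rewrite lee_fin mulr_ge0 ?sqr_ge0 ?ball_weight_ge0.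
Qed.

End eball_bound.

(** * Integral inequalities from a lower bound on the measures of sets *)

Section density.
Context d (T : measurableType d) {R : realType}.
Variables (mu lam : {measure set T -> \bar R}) (h : T -> R).
Hypotheses (mh : measurable_fun setT h) (h0 : forall x, 0 <= h x).
Hypothesis hmu : forall A, measurable A -> (\int[lam]_(x in A) (h x)%:E <= mu A)%E.
Import HBNNSimple.

Let nnsfun_density (f : {nnsfun T >-> R}) :
  (\int[lam]_x ((f x)%:E * (h x)%:E) <= \int[mu]_x (f x)%:E)%E.
Proof.
have mA y : measurable (f @^-1` [set y]).
  exact: measurable_sfunP.
have fh x : ((f x)%:E * (h x)%:E = \sum_(y \in range f)
    (y%:E * (\1_(f @^-1` [set y]) x)%:E * (h x)%:E))%E.
  rewrite fimfunE -fsumEFin// ge0_mule_fsuml// => y.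
  by rewrite EFinM nnfun_muleindic_ge0.
under eq_integral do rewrite fh.
rewrite ge0_integral_fsum//; last 2 first.
- move=> y; apply: emeasurable_funM; last exact/measurable_EFinP.
  by apply: emeasurable_funM => //; apply/measurable_EFinP.
- by move=> y x _; apply: mule_ge0; [exact: nnfun_muleindic_ge0|rewrite lee_fin].
rewrite integralT_nnsfun sintegralE; apply: lee_fsum => // y [x _ <-].
have fx0 : 0 <= f x by [].
under eq_integral do rewrite -muleA.
rewrite ge0_integralZl//; last 2 first.
- by apply: emeasurable_funM; apply/measurable_EFinP.
- by move=> z _; rewrite mule_ge0// lee_fin.
rewrite lee_wpmul2l//; apply: le_trans (hmu (mA (f x))).
rewrite le_eqVlt; apply/orP; left; apply/eqP.
rewrite [RHS]integral_mkcond; apply: eq_integral => z _.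
by rewrite patchE indicE; case: ifPn => _; rewrite ?mul1e ?mul0e.
Qed.

(** The inequality [hmu] between measures of sets passes to simple functions by linearity, and from
    them to f by monotone convergence. *)
Lemma ge0_integral_density_le (f : T -> \bar R) :
  measurable_fun setT f -> (forall x, 0 <= f x)%E ->
  (\int[lam]_x (f x * (h x)%:E) <= \int[mu]_x f x)%E.
Proof.
move=> mf f0; pose g := nnsfun_approx measurableT mf.
have gf x : (EFin \o g ^~ x) @ \oo --> f x by exact: cvg_nnsfun_approx.
have ndg x m n : (m <= n)%N -> ((g m x)%:E <= (g n x)%:E)%E.
  by move=> mn; rewrite lee_fin; exact/lefP/nd_nnsfun_approx.
have gle n x : ((g n x)%:E <= f x)%E.
  rewrite (cvg_unique _ (gf x) (ereal_nondecreasing_cvgn (ndg x)))//.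
  by apply: ereal_sup_ubound; exists n.
have gh x : (f x * (h x)%:E = limn (fun n => (g n x)%:E * (h x)%:E))%E.
  by apply/esym/cvg_lim => //; apply: cvgeZr => //; exact: gf.
under eq_integral do rewrite gh.
rewrite monotone_convergence//.
- apply: lime_le.
    apply: ereal_nondecreasing_is_cvgn => m n mn; apply: ge0_le_integral => //.
    + by move=> x _; rewrite mule_ge0// lee_fin.
    + by apply: emeasurable_funM; apply/measurable_EFinP.
    + by apply: emeasurable_funM; apply/measurable_EFinP.
    + by move=> x _; rewrite lee_wpmul2r ?lee_fin//; exact/lefP/nd_nnsfun_approx.
  apply: nearW => n; apply: le_trans (nnsfun_density (g n)) _.
  apply: ge0_le_integral => //; first by move=> x _; rewrite lee_fin.
  exact/measurable_EFinP.
- by move=> n; apply: emeasurable_funM; apply/measurable_EFinP.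
- by move=> n x _; apply: mule_ge0; rewrite lee_fin.
- by move=> x _ m n mn; rewrite lee_wpmul2r ?ndg// lee_fin.
Qed.

End density.

(** * Euclidean geometry of compact sets *)

Section borel_rV.
Context {R : realType}.

(** The sigma-algebra is generated by the coordinates, so an open set is written as the countable
    union of the rational boxes that it contains. *)
Lemma measurable_open_rV n (U : set 'rV[R]_n) : open U -> measurable U.
Proof.
move=> oU.
pose box (k : 'rV[rat]_n * nat) : set 'rV[R]_n :=
  [set y | forall i, `|ratr (k.1 ord0 i) - y ord0 i| < k.2.+1%:R^-1].
pose F k := if pselect (box k `<=` U) then box k else set0.
have mF k : measurable (F k).
  rewrite /F; case: pselect => [a|a]//=.
  rewrite (_ : box k = \bigcap_(i in [set: 'I_n])
      ((fun v : 'rV[R]_n => v ord0 i) @^-1` ball (ratr (k.1 ord0 i) : R) k.2.+1%:R^-1)).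
    apply: fin_bigcap_measurable => // i _; rewrite -[X in measurable X]setTI.
    by apply: measurable_coord => //; exact: measurable_ball.
  by apply/seteqP; split=> v /= kv i; [move=> _|]; exact: kv.
rewrite (_ : U = \bigcup_k F k); first exact: countable_bigcupT_measurable.
apply/seteqP; split => [x Ux|x [k _]]; last first.
  by rewrite /F; case: pselect => [kU|]//=; exact: kU.
have /nbhs_ballP[e /= e0 xe] := open_nbhs_nbhs (conj oU Ux).
(* The factor 2 appears because x and any other point of the box are both within 1/(k+1) of its
   centre. *)
have [k ke] : exists k : nat, 2 * k.+1%:R^-1 < e.
  exists (Num.truncn (2 / e)); rewrite ltr_pdivrMr// mulrC -ltr_pdivrMr//.
  exact: truncnS_gt.
have k0 : 0 < k.+1%:R^-1 :> R by [].
have /choice[q qx] : forall i, exists q : rat, `|ratr q - x ord0 i| < k.+1%:R^-1.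
  move=> i; have /rat_in_itvoo[q] : x ord0 i < x ord0 i + k.+1%:R^-1 by rewrite ltrDl.
  rewrite in_itv/= => /andP[q1 q2]; exists q.
  by rewrite ger0_norm ?subr_ge0 ?(ltW q1)// ltrBlDl.
exists (\row_i q i, k) => //; rewrite /F.
have xb : box (\row_i q i, k) x by move=> i /=; rewrite mxE.
case: pselect => [_//|]/= -[] y yb; apply: xe.
split=> // i j; rewrite ord1 /ball /=.
have := qx j; have := yb j; rewrite /= mxE; move: (_^-1) ke => t te h1 h2.
rewrite (_ : x _ _ - y _ _ = (ratr (q j) - y ord0 j) - (ratr (q j) - x ord0 j)); last by ring.
by rewrite (le_lt_trans (ler_normB _ _))//; lra.
Qed.

Lemma measurable_closed_rV n (A : set 'rV[R]_n) : closed A -> measurable A.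
Proof.
by move=> cA; rewrite -[A]setCK; apply: measurableC; apply: measurable_open_rV; exact: closed_openC.
Qed.

Lemma continuous_sqnorm n (c : 'rV[R]_n) : continuous (fun x : 'rV[R]_n => sqnorm (x - c)).
Proof.
rewrite (_ : (fun _ => _) = fun x : 'rV[R]_n =>
    \sum_i (x ord0 i - c ord0 i) ^+ 2); last first.
  by apply/funext => x; apply: eq_bigr => i _; rewrite !mxE.
elim: (index_enum _) => [|i s IH].
  rewrite (_ : (fun _ => _) = cst 0); first exact: cst_continuous.
  by apply/funext => x; rewrite big_nil.
rewrite (_ : (fun _ => _) = fun x : 'rV[R]_n => (x ord0 i - c ord0 i) ^+ 2 +
    \sum_(j <- s) (x ord0 j - c ord0 j) ^+ 2); last first.
  by apply/funext => x; rewrite big_cons.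
move=> x.
have h : (fun y : 'rV[R]_n => y ord0 i - c ord0 i) @ x --> (x ord0 i - c ord0 i : R).
  exact: (cvgB (@coord_continuous R 1 n ord0 i x) (cvg_cst (c ord0 i))).
exact: (cvgD (cvgM h h) (IH x)).
Qed.

Lemma dotrv_sqr_le n (x y : 'rV[R]_n) : dotrv x y ^+ 2 <= sqnorm x * sqnorm y.
Proof.
have [/eqP|y0] := eqVneq (sqnorm y) 0.
  rewrite sqnorm_eq0 => /eqP ->.
  rewrite dotrvC (_ : dotrv 0 x = 0) ?expr0n ?mulr_ge0 ?sqnorm_ge0//.
  by rewrite /dotrv big1// => i _; rewrite mxE mul0r.
have y1 : 0 < sqnorm y by rewrite lt0r y0 sqnorm_ge0.
have := sqnorm_ge0 (sqnorm y *: x - dotrv x y *: y).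
rewrite sqnormD -scaleNr !sqnormZ dotrvZl (dotrvC x) dotrvZl (dotrvC y) => h.
rewrite -subr_ge0 -(pmulr_rge0 _ y1); apply: le_trans h _.
by rewrite le_eqVlt; apply/orP; left; apply/eqP; ring.
Qed.

Lemma enorm_ge0 n (x : 'rV[R]_n) : 0 <= enorm x.
Proof. exact: sqrtr_ge0. Qed.

Lemma enormZ n a (x : 'rV[R]_n) : enorm (a *: x) = `|a| * enorm x.
Proof. by rewrite !enormE sqnormZ sqrtrM ?sqr_ge0// sqrtr_sqr. Qed.

Lemma enormN n (x : 'rV[R]_n) : enorm (- x) = enorm x.
Proof. by rewrite -scaleN1r enormZ normrN1 mul1r. Qed.

Lemma enorm_triangle n (x y : 'rV[R]_n) : enorm (x + y) <= enorm x + enorm y.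
Proof.
have h : dotrv x y <= enorm x * enorm y.
  apply: le_trans (ler_norm _) _.
  rewrite -(ler_pXn2r (n := 2)) ?nnegrE ?mulr_ge0 ?enorm_ge0//.
  by rewrite real_normK ?num_real// exprMn !enorm_sqr dotrv_sqr_le.
rewrite -(ler_pXn2r (n := 2)) ?nnegrE ?addr_ge0 ?enorm_ge0//.
by rewrite sqrrD !enorm_sqr sqnormD mulr2n; lra.
Qed.

(** The interior refers to the sup norm topology; continuity of [sqnorm] makes the Euclidean ball
    open in it. *)
Lemma open_eball_interior n (S : set 'rV[R]_n) (c y : 'rV[R]_n) (s : R) :
  closed_eball c s `<=` S -> enorm (y - c) < s -> S° y.
Proof.
move=> cS ys; have s0 : 0 < s by rewrite (le_lt_trans _ ys)// enorm_ge0.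
have oB : open ((fun x : 'rV[R]_n => sqnorm (x - c)) @^-1` [set t | t < s ^+ 2]).
  by apply: open_comp => [x _|]; [exact: continuous_sqnorm|exact: open_lt].
have lts z : (sqnorm (z - c) < s ^+ 2) = (enorm (z - c) < s).
  by rewrite -enorm_sqr ltr_pXn2r ?nnegrE ?enorm_ge0 ?(ltW s0).
have : nbhs y ((fun x : 'rV[R]_n => sqnorm (x - c)) @^-1` [set t | t < s ^+ 2]).
  by apply: open_nbhs_nbhs; split => //=; rewrite lts.
apply: filterS => z /=; rewrite lts => zs; apply: cS; exact: ltW.
Qed.

(** Move from x by s/2 in the direction of c, or in any direction if x = c. The new centre is at
    distance | |x - c| - s/2 | <= s/2 from c, so the triangle inequality gives the inclusion. *)
Lemma half_eball n (c x : 'rV[R]_n.+1) (s : R) : 0 < s -> closed_eball c s x ->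
  exists c', enorm (x - c') = s / 2 /\ closed_eball c' (s / 2) `<=` closed_eball c s.
Proof.
move=> s0 xc; rewrite /closed_eball/= in xc.
have [u u1 xu] : exists2 u : 'rV[R]_n.+1, enorm u = 1 & x - c = enorm (x - c) *: u.
  have [e|e] := eqVneq (enorm (x - c)) 0.
    exists (rV_cons (1, 0)).
      rewrite enormE sqnorm_rV_cons expr1n /sqnorm big1 ?addr0 ?sqrtr1// => i _.
      by rewrite mxE expr0n.
    rewrite e scale0r; apply/eqP; rewrite -sqnorm_eq0 -enorm_sqr e expr0n//.
  exists ((enorm (x - c))^-1 *: (x - c)); last by rewrite scalerA divff// scale1r.
  by rewrite enormZ ger0_norm ?invr_ge0 ?enorm_ge0// mulVf.
exists (x - (s / 2) *: u); split.
  by rewrite opprB addrC subrK enormZ u1 mulr1 ger0_norm// divr_ge0 ?(ltW s0).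
move=> y; rewrite /closed_eball/= => ys.
have -> : y - c = (y - (x - (s / 2) *: u)) + (enorm (x - c) - s / 2) *: u.
  by rewrite scalerBl -xu opprB !addrA; apply/rowP => i; rewrite !mxE; ring.
apply: le_trans (enorm_triangle _ _) _; rewrite enormZ u1 mulr1.
have : `|enorm (x - c) - s / 2| <= s / 2.
  by rewrite ler_norml; have := enorm_ge0 (x - c); lra.
by lra.
Qed.

(** The infimum in [dist_set] is meaningful only over a nonempty set. A point of S maximizing one
    coordinate is not interior, since a small shift would increase that coordinate within S. *)
Lemma compact_boundary_nonempty n (S : set 'rV[R]_n.+1) :
  compact S -> S !=set0 -> boundary S !=set0.
Proof.
move=> cS S0.
have cf : {within S, continuous (fun x : 'rV[R]_n.+1 => x ord0 ord0)}.
  by apply: continuous_subspaceT; exact: coord_continuous.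
have [x xS xmax] := compact_EVT_max S0 cS cf.
exists x; split; first by apply: subset_closure; rewrite inE in xS.
move=> /nbhs_ballP[e /= e0 xe].
have : S (x + const_mx (e / 2)).
  apply: xe; split => // i j; rewrite !mxE /ball/= opprD addrA subrr sub0r normrN.
  by rewrite ger0_norm ?divr_ge0 ?(ltW e0)//; lra.
by rewrite -inE => /xmax; rewrite !mxE; lra.
Qed.

Lemma dist_boundary_ge n (S : set 'rV[R]_n) (c y : 'rV[R]_n) (s : R) :
  boundary S !=set0 -> closed_eball c s `<=` S ->
  s - enorm (y - c) <= dist_set y (boundary S).
Proof.
move=> [b0 b0S] cS; apply: lb_le_inf; first by exists (enorm (y - b0)); exists b0.
move=> _ [b [_ bS] <-]; rewrite leNgt; apply/negP => h; apply: bS.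
apply: (open_eball_interior cS).
have -> : b - c = (y - c) + (b - y) by rewrite [RHS]addrC addrA subrK.
apply: le_lt_trans (enorm_triangle _ _) _.
by rewrite -[b - y]opprB enormN; lra.
Qed.

End borel_rV.

(** * Lower bound for the density inside a ball contained in S *)

Section density_lower_bound.
Context {R : realType} {n : nat}.
Variables (S : set 'rV[R]_n.+1) (w : 'rV[R]_n.+1 -> R) (C r : R).
Hypotheses (cS : compact S) (hw : forall x, S x -> 0 <= w x).
Hypotheses (C0 : 0 < C) (r0 : 0 <= r).
Hypothesis hL : forall delta : R, 0 <= delta ->
  ((C * delta `^ r)%:E <= inf_at_depth S w delta)%E.
Variables (c : 'rV[R]_n.+1) (s : R).
Hypotheses (s0 : 0 < s) (cs : closed_eball c s `<=` S).

(** With t = |y - c|/s < 1, the depth of y is at least s(1 - t), and s(1 - t) >= (s/2)(1 - t^2)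
    because 1 + t <= 2. For t >= 1 the weight is zero. *)
Lemma depth_weight_le y : S y ->
  C * (s / 2) `^ r * ball_weight r (s^-1 *: (y - c)) <= w y.
Proof.
move=> Sy; rewrite /ball_weight sqnormZ -enorm_sqr -exprMn.
set t := s^-1 * enorm (y - c).
have t0 : 0 <= t by rewrite mulr_ge0 ?enorm_ge0// invr_ge0 ltW.
have [t1|t1] := leP (1 - t ^+ 2) 0; first by rewrite pospow_le0// mulr0 hw.
have t2 : t < 1.
  by rewrite -(ltr_pXn2r (n := 2)) ?nnegrE// expr1n -subr_gt0.
have s2 : 0 < s / 2 by rewrite divr_gt0.
have d0 : 0 <= s * (1 - t) by rewrite mulr_ge0 ?(ltW s0)// subr_ge0 ltW.
apply: (@le_trans _ _ (C * (s * (1 - t)) `^ r)).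
  rewrite pospowE// -mulrA ler_pM2l// -powRM ?(ltW s2) ?(ltW t1)//.
  apply: ge0_ler_powR => //; rewrite ?nnegrE ?d0//.
    by rewrite mulr_ge0 ?(ltW s2) ?(ltW t1).
  rewrite (_ : s * (1 - t) = s / 2 * (2 * (1 - t))); last by field.
  by rewrite ler_pM2l//; nra.
rewrite -lee_fin; apply: le_trans (hL d0) _; apply: ereal_inf_lbound.
exists y => //; split => //.
have := dist_boundary_ge y (compact_boundary_nonempty cS (ex_intro _ y Sy)) cs.
apply: le_trans; rewrite le_eqVlt; apply/orP; left; apply/eqP.
by rewrite /t; field; rewrite gt_eqF.
Qed.

Lemma density_lower_bound (mu : set 'rV[R]_n.+1 -> \bar R) A :
  has_density_on mu S w -> measurable A ->
  (\int[lebesgue_rV n.+1]_(x in A)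
     (C * (s / 2) `^ r * ball_weight r (s^-1 *: (x - c)))%:E <= mu A)%E.
Proof.
move=> [g [mg wg muE]] mA; rewrite muE //.
have mS : measurable S.
  by apply: measurable_closed_rV; apply: compact_closed => //.
have mAS : measurable (A `&` S) by exact: measurableI.
set h := fun x => C * (s / 2) `^ r * ball_weight r (s^-1 *: (x - c)).
have h0 x : 0 <= h x.
  by rewrite !mulr_ge0 ?powR_ge0 ?ball_weight_ge0// ltW.
have mh : measurable_fun setT h.
  by apply: measurable_funM => //; exact: measurable_ball_weight_affine.
(* The weight lives on the ball, which lies in S, so integrating over A amounts to integrating over
   A and S together. *)
have hS x : ~ S x -> h x = 0.
  move=> Sx; rewrite /h /ball_weight pospow_le0 ?mulr0// subr_le0 leNgt.
  apply/negP => x1; apply: Sx; apply: cs; rewrite /closed_eball/=.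
  move: x1; rewrite sqnormZ -enorm_sqr -exprMn -[ltRHS](expr1n _ 2).
  rewrite ltr_pXn2r ?nnegrE ?mulr_ge0 ?enorm_ge0 ?invr_ge0 ?(ltW s0)//.
  by rewrite mulrC ltr_pdivrMr// mul1r => /ltW.
have mgA : measurable_fun (A `&` S) g.
  by apply: measurable_funS mg => // x [].
have mg1 : measurable_fun (A `&` S) (fun x => (Num.max (g x) 0)%:E).
  by apply/measurable_EFinP; apply: measurable_maxr.
(* The Borel version g of w may be negative on a null set; its positive part allows the comparison
   of nonnegative functions. *)
have -> : (\int[lebesgue_rV n.+1]_(x in A `&` S) (g x)%:E =
    \int[lebesgue_rV n.+1]_(x in A `&` S) (Num.max (g x) 0)%:E)%E.
  apply: ae_eq_integral => //; first exact/measurable_EFinP.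
  apply: filterS wg => x wgx [Ax Sx].
  by rewrite max_l// -wgx// hw.
have -> : (\int[lebesgue_rV n.+1]_(x in A) (h x)%:E =
    \int[lebesgue_rV n.+1]_(x in A `&` S) (h x)%:E)%E.
  rewrite [LHS]integral_mkcond [RHS]integral_mkcond; apply: eq_integral => x _.
  rewrite !patchE in_setI; case: (x \in A) => //=.
  by case: ifPn => //; rewrite notin_setE => /hS ->.
apply: ae_ge0_le_integral => //.
- by move=> x _; rewrite lee_fin.
- by apply/measurable_EFinP; exact: measurable_funTS.
- by move=> x _; rewrite lee_fin le_max lexx orbT.
- apply: filterS wg => x wgx [Ax Sx].
  by rewrite lee_fin le_max -wgx// depth_weight_le.
Qed.

End density_lower_bound.

(** * The bound for the Christoffel-Darboux kernel on the diagonal *)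

Lemma endpoint_kernel_gt0 (R : realType) n d (r : R) : 0 <= r ->
  0 < (endpoint_kernel (2 * r + n.+1%:R) d).[1].
Proof. by move=> r0; apply: endpoint_kernel_at1_gt0; rewrite ltr_wpDl ?mulr_ge0. Qed.

Theorem theoremB3 (R : realType) (p : nat) (hp : (1 <= p)%N)
  (S : set 'rV[R]_p) (hScompact : compact S) (hSint : S° !=set0)
  (rho : R) (hrho : 0 < rho)
  (hin : rolls_inside rho S) (hout : rolls_outside rho S)
  (w : 'rV[R]_p -> R) (hw : forall x, S x -> 0 <= w x)
  (C r : R) (hC : 0 < C) (hr : 0 <= r)
  (hL : forall delta : R, 0 <= delta ->
    ((C * delta `^ r)%:E <= inf_at_depth S w delta)%E)
  (mu : probability 'rV[R]_p R) (hmu : has_density_on mu S w)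
  (d : nat) (hd : (2 <= d)%N)
  (kappa : 'rV[R]_p -> 'rV[R]_p -> R) (hkappa : is_CD_kernel mu d kappa) :
  (ereal_sup [set (kappa x x)%:E | x in S] <=
   (4 `^ (p%:R + r) * (dim_poly p d)%:R / (C * omega p * rho `^ (p%:R + r)) *
      ((d + p + 1)%:R * (d + p + 2)%:R * (2 * d + p + 6)%:R /
       ((d + 1)%:R * (d + 2)%:R * (d + 3)%:R)) +
    2 `^ (p%:R + 2 * r) * cgamma p r / (C * rho `^ (p%:R + r)) *
      (2 * gbinom (p%:R + d%:R + 2 * r + 1) d
       - gbinom (p%:R + d%:R + 2 * r) d))%:E)%E.
Proof.
have Gamma_ge0 a : 0 <= Gamma a :> R.
  by apply: Rintegral_ge0 => t _; rewrite mulr_ge0 ?powR_ge0 ?expR_ge0.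
have omega_ge0 : 0 <= omega p :> R.
  by rewrite divr_ge0// mulr_ge0// powR_ge0.
apply: ub_ereal_sup => _ [x Sx <-]; rewrite lee_fin.
(* The first summand is only shown to be nonnegative. *)
rewrite -[leLHS]add0r; apply: lerD.
  have D0 : 0 <= C * omega p * rho `^ (p%:R + r).
    by apply: mulr_ge0; [apply: mulr_ge0 => //; exact: ltW|exact: powR_ge0].
  apply: mulr_ge0; last by rewrite divr_ge0.
  by apply: divr_ge0 => //; rewrite mulr_ge0 ?powR_ge0.
case: p hp S hScompact hSint hin hout w hw hL mu hmu kappa hkappa omega_ge0 x Sx
  => [//|n] _ S cS _ hin _ w hw hL mu hmu kappa hkappa _ x Sx.
set K := (endpoint_kernel (2 * r + n.+1%:R) d).[1].
have K0 : 0 < K by exact: endpoint_kernel_gt0.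
have -> : 2 * gbinom (n.+1%:R + d%:R + 2 * r + 1) d -
    gbinom (n.+1%:R + d%:R + 2 * r) d = K.
  rewrite /K endpoint_kernel_gbinom; last by rewrite ltr_wpDl ?mulr_ge0.
  by congr (_ * gbinom _ _ - gbinom _ _); ring.
have [c0 [xc0 c0S]] := hin x Sx.
have [c [xc cc0]] := half_eball hrho xc0.
set s := rho / 2 in xc cc0.
have s0 : 0 < s by rewrite divr_gt0.
have cS' : closed_eball c s `<=` S by move=> y /cc0/c0S.
have [[Q dQ kQ] rep] := hkappa x.
have pQ : polyfun d (peval Q) by exists Q.
set b := C * (s / 2) `^ r.
have b0 : 0 < b by rewrite mulr_gt0// powR_gt0// divr_gt0.
set M := cgamma n.+1 r * K / s ^+ n.+1 / b.
have cg0 := cgamma_gt0 n.+1 hr.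
(* As s = rho/2, rho^p = 2^p s^p and rho^r = 4^r (s/2)^r, so the powers of 2 cancel. *)
have -> : 2 `^ (n.+1%:R + 2 * r) * cgamma n.+1 r /
    (C * rho `^ (n.+1%:R + r)) * K = M.
  have two0 : 2 != 0 :> R by [].
  have -> : rho `^ (n.+1%:R + r) =
      s ^+ n.+1 * 2 ^+ n.+1 * ((s / 2) `^ r * 2 `^ r * 2 `^ r).
    rewrite powRD; last by rewrite (gt_eqF hrho) implybT.
    rewrite powR_mulrn ?(ltW hrho)// -exprMn -!powRM ?mulr_ge0 ?invr_ge0 ?(ltW s0) ?(ltW hrho)//.
    by rewrite !divfK.
  have -> : 2 `^ (n.+1%:R + 2 * r) = 2 ^+ n.+1 * (2 `^ r * 2 `^ r) :> R.
    rewrite powRD; last by rewrite two0 implybT.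
    by rewrite powR_mulrn// mulr_natl mulr2n powRD// two0 implybT.
  have : 2 `^ r != 0 :> R by rewrite gt_eqF// powR_gt0.
  have : (s / 2) `^ r != 0 by rewrite gt_eqF// powR_gt0// divr_gt0.
  have : s ^+ n.+1 != 0 by rewrite gt_eqF// exprn_gt0.
  have : 2 ^+ n.+1 != 0 :> R by rewrite gt_eqF// exprn_gt0.
  have : C != 0 by rewrite gt_eqF.
  rewrite /M /b.
  move: (cgamma _ _) ((s / 2) `^ r) (2 `^ r) (s ^+ _) (2 ^+ _) =>
    x1 x2 x3 x4 x5 h1 h2 h3 h4 h5.
  by field; rewrite h1 h2 h3 h4 h5.
have M0 : 0 < M.
  by apply: divr_gt0 => //; apply: divr_gt0; [exact: mulr_gt0|exact: exprn_gt0].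
have mQ := measurable_polyfun pQ.
have bound : ((peval Q x ^+ 2)%:E <= M%:E * \int[mu]_y (peval Q y ^+ 2)%:E)%E.
  have := eball_endpoint_bound hr pQ s0 xc.
  move=> /le_trans; apply; rewrite -/K /M.
  rewrite [M%:E]EFinM -muleA lee_wpmul2l//.
    by rewrite lee_fin; apply: divr_ge0; apply: ltW; [exact: mulr_gt0|exact: exprn_gt0].
  have mbw := measurable_ball_weight_affine r c s^-1.
  have mQ2 : measurable_fun setT (fun y : 'rV[R]_n.+1 => (peval Q y ^+ 2)%:E).
    by apply/measurable_EFinP; exact: measurable_funX.
  have bw0 y : 0 <= b * ball_weight r (s^-1 *: (y - c)).
    by rewrite mulr_ge0 ?ball_weight_ge0// ltW.
  have mb : measurable_fun setT
      (fun y : 'rV[R]_n.+1 => b * ball_weight r (s^-1 *: (y - c))).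
    exact: measurable_funM.
  have dens := ge0_integral_density_le mb bw0
    (fun A mA => density_lower_bound cS hw hC hr hL s0 cS' hmu mA) mQ2.
  apply: (@le_trans _ _ ((b^-1)%:E * (b%:E * \int[lebesgue_rV n.+1]_y
      (peval Q y ^+ 2 * ball_weight r (s^-1 *: (y - c)))%:E))%E).
    by rewrite muleA -EFinM mulVf ?mul1e// gt_eqF.
  rewrite lee_wpmul2l ?lee_fin ?invr_ge0 ?(ltW b0)//.
  rewrite -ge0_integralZl//=; last 3 first.
  - apply/measurable_EFinP; apply: measurable_funM => //; exact: measurable_funX.
  - by move=> y _; rewrite lee_fin mulr_ge0 ?sqr_ge0 ?ball_weight_ge0.
  - by rewrite lee_fin ltW.
  under eq_integral do rewrite -EFinM mulrCA EFinM.
  by apply: dens => y; rewrite lee_fin sqr_ge0.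
rewrite kQ.
(* Here Q is kappa(x, .) itself, so the reproducing property gives Q(x) as the integral of Q^2. The
   bound becomes Q(x)^2 <= M Q(x), to be divided by Q(x). *)
have qE : fine (\int[mu]_y (peval Q y ^+ 2)%:E)%E = peval Q x.
  rewrite -(rep _ dQ) /Rintegral; congr fine; apply: eq_integral => y _.
  by rewrite kQ expr2.
have I0 : (0 <= \int[mu]_y (peval Q y ^+ 2)%:E)%E.
  by apply: integral_ge0 => y _; rewrite lee_fin sqr_ge0.
(* Were the integral infinite, its [fine] value 0 would be Q(x), and the claim would reduce to 0 <=
   M. *)
move: qE I0 bound; case: (\int[mu]_y _)%E => [q| |]//=; last first.
  by move=> <- _ _; exact: ltW.
move=> <- _; rewrite lee_fin => qM.
have [q0|q0] := leP q 0; first exact: le_trans (ltW M0).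
by rewrite expr2 ler_pM2r in qM.
Qed.
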